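(* Let $\mathcal U = \{u_1, \ldots, u_k\}$ be a finite set of non-zero vectors that generate $\mathbb Z^d$ as a group. Let $Z_0$ be the sumset $\{0, u_1\} + \{0, u_2\} + \cdots + \{0, u_k\}$ and let $Z$ be the convex hull of $Z_0$ in $\mathbb R^d$. For every $\delta > 0$, there is an $n_0 = n_0(\delta, \mathcal U)$ such that, for every $n \geq n_0$, \[ (1-\delta)\, d \operatorname{vol}(Z)^{1/d}\, n^{1-1/d} \;\le\; \partial^*_{G_{\mathcal U}}(n) \;\le\; (1+\delta)\, d \operatorname{vol}(Z)^{1/d}\, n^{1-1/d}. \] The upper bound is witnessed by intersections of scaled copies of $Z$ with $\mathbb Z^d$.
   Context: $G_{\mathcal U}$ is the directed Cayley graph with vertex set $\mathbb Z^d$ and edge set $\{(v, v+u) : v \in \mathbb Z^d, u \in \mathcal U\}$. For a finite $S \subset \mathbb Z^d$, the edge boundary $\partial_{G_{\mathcal U}}(S)$ is the number of edges leaving $S$, that is, the number of edges $(v,w)$ of $G_{\mathcal U}$ with $v \in S$ and $w \in \mathbb Z^d \setminus S$. For a positive integer $n$, $\partial^*_{G_{\mathcal U}}(n) = \min\{\partial_{G_{\mathcal U}}(S) : S \subset \mathbb Z^d, |S| = n\}$. The sumset (Minkowski sum) is $A + B = \{a+b : a \in A, b \in B\}$, a scaled copy of $Z$ is a dilation $t \cdot Z = \{tz : z \in Z\}$, and $\operatorname{vol}$ is $d$-dimensional volume. *)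

(* Defs.v *)
From HB Require Import structures.
From mathcomp Require Import all_boot all_order all_algebra finmap.
From mathcomp Require Import all_classical all_reals all_analysis.

Set Implicit Arguments.
Unset Strict Implicit.
Unset Printing Implicit Defensive.

Import Order.TTheory GRing.Theory Num.Theory.

Local Open Scope fset_scope.
Local Open Scope classical_set_scope.
Local Open Scope ring_scope.

Definition generates (V : zmodType) (U : {fset V}) : Prop :=
  forall H : {pred V},
    GRing.zmod_closed H -> {subset U <= H} -> forall v, v \in H.

(* The endpoints of an edge e determine its direction u = e.2 - e.1,
   so collecting edges as pairs counts every directed edge exactly once. *)
Definition edge_boundary (V : zmodType) (U S : {fset V}) : nat :=
  #|` [fset e in [fset (v, v + u) | v in S, u in U] | e.2 \notin S] |.

(* xget only supplies the value 0 when V has no finite subset of size n;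
   by edge_isoperimetryP this does not happen in 'rV[int]_d with d > 0. *)
Definition edge_isoperimetry (V : zmodType) (U : {fset V}) (n : nat) : nat :=
  xget 0%N [set m | (exists2 S : {fset V}, #|` S| = n & edge_boundary U S = m)
    /\ forall S : {fset V}, #|` S| = n -> (m <= edge_boundary U S)%N].

Lemma edge_isoperimetryP (d : nat) (U : {fset 'rV[int]_d}) (n : nat) :
  (0 < d)%N ->
  (exists2 S : {fset 'rV[int]_d},
     #|` S| = n & edge_boundary U S = edge_isoperimetry U n)
  /\ forall S : {fset 'rV[int]_d},
       #|` S| = n -> (edge_isoperimetry U n <= edge_boundary U S)%N.
Proof.
move=> d0; rewrite /edge_isoperimetry; set M := [set m | _].
suff [m Mm] : M !=set0 by have := xgetPex 0%N (ex_intro _ m Mm : exists m, M m).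
pose P m := `[< exists2 S : {fset 'rV[int]_d}, #|` S| = n
                & edge_boundary U S = m >].
have exP : exists m, P m.
  pose S := [fset (const_mx (k : nat)%:Z : 'rV[int]_d) | k in iota 0 n].
  exists (edge_boundary U S); apply/asboolP; exists S => //.
  rewrite card_imfset /=; first by rewrite undup_id ?iota_uniq ?size_iota.
  by move=> i j /matrixP /(_ 0 (Ordinal d0)); rewrite !mxE => -[].
have [m /asboolP[S Sn Sm] mmin] := ex_minnP exP.
exists m; split; first by exists S.
by move=> T Tn; apply: mmin; apply/asboolP; exists T.
Qed.

Definition sumset (V : zmodType) (A B : {fset V}) : {fset V} :=
  [fset a + b | a in A, b in B].

Definition subset_sums (V : zmodType) (U : {fset V}) : {fset V} :=
  \big[@sumset V/[fset 0]]_(u <- U) [fset 0; u].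

Definition int_vec (R : realType) (d : nat) (v : 'rV[int]_d) : 'rV[R]_d :=
  map_mx intr v.

Definition convex_hull (R : realType) (E : lmodType R) (A : set E) : set E :=
  smallest (@convex_set R E) A.

Definition zonotope (R : realType) (d : nat) (U : {fset 'rV[int]_d}) :
    set 'rV[R]_d :=
  convex_hull (@int_vec R d @` [set` subset_sums U]).
Arguments zonotope R {d} U.

Definition dilation (R : realType) (E : lmodType R) (t : R) (A : set E) :
    set E :=
  [set t *: z | z in A].

Definition lattice_points (R : realType) (d : nat) (A : set 'rV[R]_d) :
    set 'rV[int]_d :=
  [set v | A (int_vec R v)].

Definition closed_box (R : realType) (d : nat) (a b : 'rV[R]_d) :
    set 'rV[R]_d :=
  [set x : 'rV[R]_d | forall i, a 0 i <= x 0 i <= b 0 i].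

(* Lebesgue outer measure on R^d: infimum of the total volume of countable
   covers by closed boxes (degenerate boxes allowed). *)
Definition lebesgue_outer (R : realType) (d : nat) (A : set 'rV[R]_d) :
    \bar R :=
  ereal_inf [set s | exists a b : nat -> 'rV[R]_d,
    [/\ forall k i, a k 0 i <= b k 0 i,
        A `<=` \bigcup_k closed_box (a k) (b k) &
        s = (\sum_(0 <= k <oo) (\prod_(i < d) (b k 0 i - a k 0 i))%:E)%E]].

(* Agrees with d-dimensional volume (d > 0) on bounded Lebesgue-measurable
   sets, in particular on polytopes. *)
Definition vol (R : realType) (d : nat) (A : set 'rV[R]_d) : R :=
  fine (lebesgue_outer A).

Definition isoperimetric_bound (R : realType) (d : nat)
    (U : {fset 'rV[int]_d}) (n : nat) : R :=
  d%:R * (vol (zonotope R U) `^ d%:R^-1) * (n%:R `^ (1 - d%:R^-1)).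
Arguments isoperimetric_bound R {d} U n.

(* Main.v *)
(* For u in U write leaving S u = (S + u) \ S, so that the edge boundary of S is
   the sum of the sizes of these sets, and let jZ_0 be the j-fold sumset of Z_0,
   called multiset_sums U j.  Every point of jZ is within a bounded lattice
   vector of jZ_0 and U generates, so jZ is covered by |(j + c)Z_0| unit boxes;
   together with compactness of Z this gives |jZ_0| ~ vol(Z) j^d.

   Lower bound.  Let f(x) be the number of q in rZ_0 with x - q in S, and F_l
   the set where f > l, for l < |rZ_0|.  Moving x by a vector of mZ_0 one
   generator at a time changes f by a controlled number of points of the sets
   leaving S u, so on average over l the set F_l + mZ_0 exceeds F_l by at most
   m |(r + m)Z_0| / |rZ_0| times the boundary of S.  By the discrete
   Brunn-Minkowski inequality |A + B + {0,1}^d|^(1/d) >= |A|^(1/d) + |B|^(1/d),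
   whose cube is absorbed by boundedly many copies of Z_0, the excess is at
   least about d m vol(Z)^(1/d) |F_l| / |S + rZ_0|^(1/d).  Fix m large, then r
   much larger, and let |S| grow: |S + rZ_0| ~ |S| unless the boundary is
   already large.

   Upper bound.  If S consists of the lattice points of tZ, every line in
   direction u meets S in an interval, so adding u to any finite superset of S
   gains at least |leaving S u| points.  Hence S + mZ_0, which lies in (t + m)Z,
   has at least |S| + m * boundary(S) points; compare volumes with m a small
   multiple of t.  To reach a prescribed cardinality, delete points of maximal
   Euclidean norm, which never increases the boundary. *)
Require Import Defs.
From HB Require Import structures.
From mathcomp Require Import all_boot all_order all_algebra finmap.
From mathcomp Require Import all_classical all_reals all_analysis.
From mathcomp Require Import zify ring lra.

Set Implicit Arguments.
Unset Strict Implicit.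
Unset Printing Implicit Defensive.

Import Order.TTheory GRing.Theory Num.Theory.

Local Open Scope fset_scope.
Local Open Scope classical_set_scope.
Local Open Scope ring_scope.

(** * Sumsets and edge boundaries *)

Section Combinatorics.
Local Open Scope fset_scope.
Local Open Scope ring_scope.
Variable V : zmodType.
Implicit Types (A B S T P Q U : {fset V}) (u v w x y z : V) (ws : seq V).

Lemma card_sep (K : choiceType) (X : {fset K}) (p : pred K) :
  #|` [fset x in X | p x]| = (\sum_(x <- X) p x)%N.
Proof.
rewrite card_fset_sum1 big_fset /= big_mkcond /=.
by apply: eq_bigr => x _; case: (p x).
Qed.

Lemma mem_sumsetP A B x :
  reflect (exists2 a, a \in A & exists2 b, b \in B & x = a + b)
          (x \in sumset A B).
Proof.
apply: (iffP (imfset2P _ _ _ _ _)) => /=.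
  by move=> [a aA [b bB ->]]; exists a => //; exists b.
by move=> [a aA [b bB ->]]; exists a => //; exists b.
Qed.

Lemma mem_sumset A B a b : a \in A -> b \in B -> a + b \in sumset A B.
Proof. by move=> aA bB; apply/mem_sumsetP; exists a => //; exists b. Qed.

Lemma sumsetA A B T : sumset A (sumset B T) = sumset (sumset A B) T.
Proof.
apply/fsetP => x; apply/mem_sumsetP/mem_sumsetP.
- move=> [a aA [_ /mem_sumsetP[b bB [t tT ->]] ->]].
  by exists (a + b); [exact: mem_sumset | exists t => //; rewrite addrA].
- move=> [_ /mem_sumsetP[a aA [b bB ->]] [t tT ->]].
  by exists a => //; exists (b + t); [exact: mem_sumset | rewrite addrA].
Qed.

Lemma sumsetC A B : sumset A B = sumset B A.
Proof.
by apply/fsetP => x; apply/mem_sumsetP/mem_sumsetP => -[a aA [b bB ->]];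
  exists b => //; exists a => //; rewrite addrC.
Qed.

Lemma sumset0l A : sumset [fset 0] A = A.
Proof.
apply/fsetP => x; apply/mem_sumsetP/idP.
  by move=> [a /fset1P -> [b bB ->]]; rewrite add0r.
by move=> xA; exists 0; [exact/fset1P | exists x; rewrite ?add0r].
Qed.

Lemma sumsetS A B T : A `<=` B -> sumset A T `<=` sumset B T.
Proof.
move=> /fsubsetP AB; apply/fsubsetP => x /mem_sumsetP[a aA [t tT ->]].
by apply: mem_sumset => //; exact: AB.
Qed.

Lemma sumset_subl A B : 0 \in B -> A `<=` sumset A B.
Proof.
by move=> B0; apply/fsubsetP => x xA; rewrite -[x]addr0; exact: mem_sumset.
Qed.

Definition seq_sums ws : {fset V} :=
  \big[@sumset V/[fset 0]]_(u <- ws) [fset 0; u].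

Lemma seq_sums_nil : seq_sums [::] = [fset 0].
Proof. by rewrite /seq_sums big_nil. Qed.

Lemma seq_sums_cons w ws :
  seq_sums (w :: ws) = sumset [fset 0; w] (seq_sums ws).
Proof. by rewrite /seq_sums big_cons. Qed.

Lemma seq_sums_cat ws1 ws2 :
  seq_sums (ws1 ++ ws2) = sumset (seq_sums ws1) (seq_sums ws2).
Proof.
elim: ws1 => [|w ws1 IH] /=; first by rewrite seq_sums_nil sumset0l.
by rewrite !seq_sums_cons IH sumsetA.
Qed.

Lemma seq_sums0 ws : 0 \in seq_sums ws.
Proof.
elim: ws => [|w ws IH]; first by rewrite seq_sums_nil fset11.
by rewrite seq_sums_cons -{1}[0]addr0; apply: mem_sumset => //; rewrite !inE eqxx.
Qed.

(** Concatenating j copies of [U] into one sequence lets inductions add a single generator at a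
    time. *)
Definition multiset_sums U (j : nat) : {fset V} :=
  seq_sums (flatten (nseq j (enum_fset U))).

Lemma multiset_sumsD U i j :
  multiset_sums U (i + j) = sumset (multiset_sums U i) (multiset_sums U j).
Proof. by rewrite /multiset_sums nseqD flatten_cat seq_sums_cat. Qed.

Lemma multiset_sums1 U : multiset_sums U 1 = subset_sums U.
Proof. by rewrite /multiset_sums /= cats0. Qed.

Lemma multiset_sums_mem0 U j : 0 \in multiset_sums U j.
Proof. exact: seq_sums0. Qed.

Lemma multiset_sums_homo U i j :
  (i <= j)%N -> multiset_sums U i `<=` multiset_sums U j.
Proof.
move=> ij; rewrite -(subnKC ij) multiset_sumsD.
exact/sumset_subl/multiset_sums_mem0.
Qed.

Lemma mem_multiset_sums1 U u : u \in U -> u \in multiset_sums U 1.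
Proof.
rewrite /multiset_sums /= cats0 -[u \in U]/(u \in enum_fset U).
elim: (enum_fset U) => // w ws IH.
rewrite inE seq_sums_cons => /predU1P[->|/IH uws].
  by rewrite -{1}[w]addr0; apply: mem_sumset; rewrite ?seq_sums0 // !inE eqxx orbT.
by rewrite -[u]add0r; apply: mem_sumset => //; rewrite !inE eqxx.
Qed.

(** The differences of two points of a common cZ_0 form a subgroup containing [U], hence everything.
    In this way unit cubes and rounding errors are absorbed into boundedly many copies of Z_0. *)
Lemma generates_multiset_sums U (F : {fset V}) : generates U ->
  exists c w, {in F, forall x, x + w \in multiset_sums U c}.
Proof.
move=> Ugen.
pose H := [pred x | `[< exists c w, w \in multiset_sums U c /\
   x + w \in multiset_sums U c >]].
have HV x : x \in H.
  apply: Ugen => [|u uU]; last first.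
    apply/asboolP; exists 1%N, 0; rewrite addr0.
    by split; [exact: multiset_sums_mem0 | exact: mem_multiset_sums1].
  split; first by apply/asboolP; exists 0%N, 0; rewrite addr0 multiset_sums_mem0.
  move=> y z /asboolP[c [w [wc ywc]]] /asboolP[e [t [te zte]]].
  apply/asboolP; exists (c + e)%N, (w + (z + t)); rewrite multiset_sumsD.
  split; first exact: mem_sumset.
  have -> : y - z + (w + (z + t)) = (y + w) + t by rewrite addrACA addKr.
  exact: mem_sumset.
(* Keeping [w] itself in cZ_0 allows a new point x to be added with its own shift t, since x + (w +
   t) = w + (x + t). *)
suff [c [w [_ cw]]] : exists c w, w \in multiset_sums U c /\
  {in enum_fset F, forall x, x + w \in multiset_sums U c} by exists c, w.
elim: (enum_fset F) => [|x s [c [w [wc sw]]]].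
  by exists 0%N, 0; split => //; exact: multiset_sums_mem0.
have /asboolP[e [t [te xte]]] := HV x.
exists (c + e)%N, (w + t); rewrite multiset_sumsD.
split=> [|y]; first exact: mem_sumset.
rewrite inE => /predU1P[->|ys].
  by rewrite addrCA; exact: mem_sumset.
by rewrite addrA; apply: mem_sumset => //; exact: sw.
Qed.

Definition translate S u : {fset V} := [fset x + u | x in S].

Lemma mem_translate S u x : (x \in translate S u) = (x - u \in S).
Proof.
apply/imfsetP/idP => [[y yS ->]|xS]; first by rewrite addrK.
by exists (x - u) => //; rewrite subrK.
Qed.

Lemma card_translate S u : #|` translate S u| = #|` S|.
Proof. by rewrite card_imfset //; exact: addIr. Qed.

(** Each edge in direction u is recorded by its head, so these are exactly the points that adding
    {0, u} contributes to S. *)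
Definition leaving S u : {fset V} := translate S u `\` S.

Lemma mem_leaving S u x : (x \in leaving S u) = (x \notin S) && (x - u \in S).
Proof. by rewrite in_fsetD mem_translate. Qed.

Lemma card_leaving S u : #|` leaving S u| = #|` [fset x in S | x + u \notin S]|.
Proof.
rewrite -(card_translate [fset x in S | _] u); congr (#|` _|).
apply/fsetP => x; rewrite mem_leaving mem_translate !inE /= subrK andbC.
by [].
Qed.

Lemma edge_boundaryE U S :
  edge_boundary U S = (\sum_(u <- U) #|` leaving S u|)%N.
Proof.
rewrite /edge_boundary card_sep big_imfset2 /=; last first.
  move=> [x u] [y v] /= _ _ [-> /addrI ->] //.
rewrite exchange_big /=; apply: eq_bigr => u _.
by rewrite card_leaving card_sep.
Qed.

Lemma card_sumset_pair S u :
  #|` sumset S [fset 0; u]| = (#|` S| + #|` leaving S u|)%N.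
Proof.
rewrite -cardfsUI (_ : S `&` _ = fset0) ?cardfs0 ?addn0; last first.
  by apply/fsetP => x; rewrite in_fsetI mem_leaving inE; case: (x \in S).
congr (#|` _|); apply/fsetP => x; rewrite in_fsetU mem_leaving.
apply/mem_sumsetP/idP => [[y yS [t]]|].
  rewrite !inE => /orP[] /eqP-> ->; rewrite ?addr0 ?yS //.
  by rewrite addrK yS andbT orbN.
case/orP => [xS|/andP[_ xS]].
  by exists x => //; exists 0; rewrite ?addr0 // !inE eqxx.
by exists (x - u) => //; exists u; rewrite ?subrK // !inE eqxx orbT.
Qed.

End Combinatorics.

(** * Growth of sumsets in terms of the edge boundary *)

Section Combinatorics2.
Local Open Scope fset_scope.
Local Open Scope ring_scope.
Variable V : zmodType.
Implicit Types (A B S T P Q U : {fset V}) (u v w x y z : V) (ws : seq V).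

Lemma sum_mem_le (K : choiceType) (X A : {fset K}) :
  (\sum_(x <- X) (x \in A) <= #|` A|)%N.
Proof.
rewrite -(card_sep X (mem A)); apply: fsubset_leq_card.
by apply/fsubsetP => x; rewrite !inE /= => /andP[].
Qed.

Lemma sum_mem (K : choiceType) (X A : {fset K}) : A `<=` X ->
  (\sum_(x <- X) (x \in A) = #|` A|)%N.
Proof.
move=> /fsubsetP AX; rewrite -(card_sep X (mem A)); congr (#|` _|).
by apply/fsetP => x; rewrite !inE /=; apply: andb_idl; exact: AX.
Qed.

(** By iteration, S meets every progression in direction u in consecutive points. *)
Definition convex_along S u :=
  forall x k, x \in S -> x + u *+ k.+1 \in S -> x + u \in S.

(* Each u-line meeting S contains exactly one point of leaving S u; moving it
   along u until it first exits T injects leaving S u into leaving T u. *)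
Lemma card_leaving_homo S T u : (forall k, u *+ k.+1 != 0) ->
  convex_along S u -> S `<=` T -> (#|` leaving S u| <= #|` leaving T u|)%N.
Proof.
move=> u_tf Sconv /fsubsetP ST.
(* Otherwise the ray from y would contain more than |T| distinct points of T. *)
have exitT y : exists i, y + u *+ i \notin T.
  apply: contrapT => /forallNP inT.
  have [n nT] : {n | n = #|` T|.+1} by exists #|` T|.+1.
  pose X := [fset y + u *+ i | i in iota 0 n].
  have : (#|` X| <= #|` T|)%N.
    apply/fsubset_leq_card/fsubsetP => _ /imfsetP[i _ ->].
    by apply: contraT => /inT.
  rewrite card_in_imfset /=; first by rewrite undup_id ?iota_uniq // size_iota nT ltnn.
  move=> i j _ _ /addrI; wlog ij : i j / (i <= j)%N.
    by move=> W; case/orP: (leq_total i j) => [/W//|/W + /esym e] => /(_ e).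
  move=> e; apply/eqP; rewrite eqn_leq ij leqNgt; apply/negP => lij.
  have := u_tf (j - i.+1)%N; rewrite subnSK // mulrnBr //.
  by rewrite e subrr eqxx.
pose e y := ex_minn (exitT y).
pose phi y := y + u *+ e y.
have inj : {in leaving S u &, injective phi}.
  have aux y z : y \in leaving S u -> z \in leaving S u -> phi y = phi z ->
      (e y <= e z)%N -> y = z.
    rewrite !mem_leaving => /andP[_ yS] /andP[zNS zS].
    rewrite /phi => E le.
    have -> : y = z + u *+ (e z - e y).
      by rewrite mulrnBr // addrA -E addrK.
    case ek: (e z - e y)%N => [|k].
      by rewrite addr0.
    (* Here y - u = (z - u) + (k + 1) u, so convexity along u would put z in S. *)
    case/negP: zNS; rewrite -[z](subrK u); apply: (Sconv _ k) => //.
    by rewrite addrAC -ek mulrnBr // addrA -E addrK.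
  move=> y z yl zl E; case/orP: (leq_total (e y) (e z)) => le.
    exact: aux.
  by apply/esym/aux.
have <- : #|` [fset phi y | y in leaving S u]| = #|` leaving S u|.
  by rewrite card_in_imfset.
apply/fsubset_leq_card/fsubsetP => _ /imfsetP[y /= yl ->].
move: yl; rewrite !mem_leaving /phi /e; case: ex_minnP => i iT imin /andP[_ yS].
rewrite iT /=; case: i iT imin => [|i] iT imin; first by rewrite addr0 ST.
by apply: contraT; rewrite mulrSr addrA addrK => /imin; rewrite ltnn.
Qed.

(** Generators are added one at a time, and [card_leaving_homo] compares S with the partial sumset.
    Only S has to be convex along the generators, not the partial sumsets. *)
Lemma card_sumset_convex S ws :
  {in ws, forall w, (forall k, w *+ k.+1 != 0) /\ convex_along S w} ->
  (#|` S| + \sum_(w <- ws) #|` leaving S w| <= #|` sumset S (seq_sums ws)|)%N.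
Proof.
elim: ws => [|w ws IH] H.
  by rewrite big_nil seq_sums_nil sumsetC sumset0l addn0.
have [w_tf Sw] := H w (mem_head _ _).
have {}IH := IH (fun v vws => H v (mem_behead (s := w :: ws) vws)).
rewrite big_cons seq_sums_cons addnCA addnC.
rewrite (sumsetC [fset 0; w]) sumsetA card_sumset_pair leq_add //.
exact/card_leaving_homo/sumset_subl/seq_sums0.
Qed.

(** A path of generators from a point of S to a point outside S must leave S at one of its steps. *)
Lemma card_leaving_seq S ws q : q \in seq_sums ws ->
  (#|` leaving S q| <= \sum_(w <- ws) #|` leaving S w|)%N.
Proof.
elim: ws q => [|w ws IH] q.
  rewrite seq_sums_nil => /fset1P ->; rewrite big_nil leqn0 cardfs_eq0.
  by apply/eqP/fsetP => x; rewrite mem_leaving subr0 inE andNb.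
rewrite seq_sums_cons => /mem_sumsetP[b wb [p pws ->]].
rewrite big_cons; move: wb; rewrite !inE => /orP[] /eqP->.
  by rewrite add0r (leq_trans (IH _ pws)) // leq_addl.
apply: (@leq_trans #|` leaving S w `|` translate (leaving S p) w|).
  apply/fsubset_leq_card/fsubsetP => x.
  rewrite in_fsetU mem_translate !mem_leaving => /andP[-> xS] /=.
  by rewrite -(addrA x) -opprD xS andbT orbN.
by rewrite (leq_trans (leq_card_fsetU _ _)) // card_translate leq_add2l IH.
Qed.

(** Every point of the sumset outside S lies in [leaving S q] for some q. The crude factor is
    harmless when the number of copies of Z_0 is fixed and S is large. *)
Lemma card_sumset_le S ws :
  (#|` sumset S (seq_sums ws)| <= #|` S| +
     #|` seq_sums ws| * \sum_(w <- ws) #|` leaving S w|)%N.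
Proof.
set Q := seq_sums ws.
rewrite -(cardfsID S) leq_add ?fsubset_leq_card ?fsubsetIr //.
set X := _ `\` S; rewrite card_fset_sum1.
apply: (@leq_trans (\sum_(x <- X) \sum_(q <- Q) (x \in leaving S q))%N).
  rewrite big_seq [leqRHS]big_seq; apply: leq_sum => x.
  rewrite in_fsetD => /andP[xS /mem_sumsetP[s sS [q qQ xE]]].
  by rewrite (big_fsetD1 q) //= mem_leaving xS xE addrK sS.
rewrite exchange_big /=.
apply: (@leq_trans (\sum_(q <- Q) \sum_(w <- ws) #|` leaving S w|)%N).
  rewrite big_seq [leqRHS]big_seq; apply: leq_sum => q qQ.
  exact: leq_trans (sum_mem_le _ _) (card_leaving_seq _ qQ).
by rewrite big_const_seq count_predT iter_addn_0 mulnC.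
Qed.

(** * Convolutions of indicator functions and their level sets *)

Definition multiplicity P A x := #|` [fset p in P | x - p \in A]|.

Definition level_set P A l := [fset x in sumset A P | (l < multiplicity P A x)%N].

Lemma sum_ltn_ord n m : (\sum_(l < n) (l < m) = minn n m)%N.
Proof. by elim: n => [|n IH]; rewrite ?big_ord0 ?big_ord_recr /= ?IH; lia. Qed.

Lemma sum_multiplicity (X A P : {fset V}) :
  (\sum_(x <- X) multiplicity P A x <= #|` P| * #|` A|)%N.
Proof.
under eq_bigr => x _ do rewrite /multiplicity card_sep.
rewrite exchange_big /=.
rewrite (_ : (_ * _)%N = \sum_(p <- P) #|` A|)%N.
  apply: leq_sum => p _; under eq_bigr => x _ do rewrite -mem_translate.
  by apply: leq_trans (sum_mem_le _ _) _; rewrite card_translate.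
by rewrite big_const_seq count_predT iter_addn_0 mulnC.
Qed.

(** Both sides count the pairs in Q x S, the left one according to their sum. *)
Lemma sum_level_set Q S :
  (\sum_(l < #|` Q|) #|` level_set Q S l| = #|` Q| * #|` S|)%N.
Proof.
under eq_bigr => l _ do rewrite /level_set card_sep.
rewrite exchange_big /=.
transitivity (\sum_(x <- sumset S Q) multiplicity Q S x)%N.
  apply: eq_bigr => x _; rewrite sum_ltn_ord; apply/minn_idPr.
  by apply/fsubset_leq_card/fsubsetP => q; rewrite !inE => /andP[].
under eq_bigr => x _ do rewrite /multiplicity card_sep.
rewrite exchange_big /=.
under eq_big_seq => q qQ.
  under eq_bigr => x _ do rewrite -mem_translate.
  rewrite sum_mem ?card_translate; first over.
  apply/fsubsetP => x; rewrite mem_translate => xS.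
  by rewrite -[x](subrK q); exact: mem_sumset.
by rewrite big_const_seq count_predT iter_addn_0 mulnC.
Qed.

(** At a step w after a displacement y, a q that is counted only after the step satisfies x - y - q
    in [leaving S w]. Then q + y lies in P and is counted by the convolution of P with [leaving S w]
    at x. *)
Lemma multiplicity_path P Q S ws x z :
  sumset Q (seq_sums ws) `<=` P -> z \in seq_sums ws ->
  (multiplicity Q S (x - z) <= multiplicity Q S x +
     \sum_(w <- ws) multiplicity P (leaving S w) x)%N.
Proof.
elim: ws z => [|w ws IH] z.
  by rewrite seq_sums_nil => _ /fset1P ->; rewrite subr0 big_nil addn0.
rewrite !seq_sums_cons big_cons (sumsetC [fset 0; w]) sumsetA => QP.
have QP' : sumset Q (seq_sums ws) `<=` P.
  by apply: fsubset_trans QP; apply: sumset_subl; rewrite !inE eqxx.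
move=> /mem_sumsetP[y yws [b wb ->]].
move: wb; rewrite !inE => /orP[] /eqP->.
  by rewrite addr0 (leq_trans (IH _ QP' yws)) // leq_add2l leq_addl.
set E := multiplicity P _ x.
apply: (@leq_trans (E + multiplicity Q S (x - y))%N); last first.
  by rewrite addnCA leq_add2l IH.
pose D := [fset q in Q | x - y - q \in leaving S w].
have DE : (#|` D| <= E)%N.
  rewrite -(card_translate D y); apply/fsubset_leq_card/fsubsetP => p.
  rewrite mem_translate !inE /= => /andP[pQ pl]; apply/andP; split.
    apply: (fsubsetP QP'); rewrite -[p](subrK y); exact: mem_sumset.
  by move: pl; rewrite opprB addrA subrK.
apply: leq_trans (leq_add DE (leqnn _)).
rewrite addnC; apply: leq_trans (leq_card_fsetU _ _).
apply/fsubset_leq_card/fsubsetP => q.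
rewrite in_fsetU !inE /=. rewrite mem_translate => /andP[-> /=].
rewrite opprD addrA (addrAC (x - y) (- w)) => ->.
by rewrite andbT orbN.
Qed.

(** If x lies in the l-th level set plus z, then l is below the multiplicity at x - z, hence below
    the path bound at x. Summing over l and then over x gives the estimate. *)
Lemma sum_level_set_sumset P Q S ws :
  sumset Q (seq_sums ws) `<=` P ->
  (\sum_(l < #|` Q|) #|` sumset (level_set Q S l) (seq_sums ws)| <=
   #|` Q| * #|` S| + #|` P| * \sum_(w <- ws) #|` leaving S w|)%N.
Proof.
move=> QP; set Z := seq_sums ws.
pose X := sumset (sumset S Q) Z.
pose E x := (\sum_(w <- ws) multiplicity P (leaving S w) x)%N.
have subX l : sumset (level_set Q S l) Z `<=` X.
  by apply: sumsetS; apply/fsubsetP => x; rewrite !inE /= => /andP[].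
rewrite (eq_bigr (fun l : 'I_ _ =>
  \sum_(x <- X) (x \in sumset (level_set Q S l) Z))%N); last first.
  by move=> l _; rewrite (sum_mem (subX l)).
rewrite exchange_big /=.
apply: (@leq_trans (\sum_(x <- X) (multiplicity Q S x + E x))%N).
  apply: leq_sum => x _; set m := (_ + _)%N.
  apply: (@leq_trans (\sum_(l < #|` Q|) (l < m))%N).
    apply: leq_sum => l _; case: mem_sumsetP => // -[y yl [z zZ xE]].
    rewrite lt0b; move: yl; rewrite !inE /= => /andP[_ ly].
    by apply: leq_trans ly _; rewrite -[y](addrK z) -xE multiplicity_path.
  by rewrite sum_ltn_ord geq_minr.
rewrite big_split leq_add //=; first exact: sum_multiplicity.
rewrite exchange_big /= big_distrr leq_sum //= => w _.
exact: sum_multiplicity.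
Qed.
End Combinatorics2.

(** * A discrete Brunn-Minkowski inequality *)

Section BrunnMinkowski.
Local Open Scope fset_scope.
Local Open Scope ring_scope.

Lemma fset_argmax (K : choiceType) (T : realDomainType) (S : {fset K})
    (q : K -> T) : S != fset0 ->
  exists2 x, x \in S & {in S, forall y, q y <= q x}.
Proof.
move=> /fset0Pn[x0 x0S].
have [x _ xmax] := arg_maxP (fun x : S => q (val x)) (erefl (predT [` x0S])).
exists (val x); first exact: valP.
by move=> y yS; exact: (xmax [` yS]).
Qed.

(** The sets A + min B and max A + B + 1 both lie in C; the extra 1 makes them disjoint. *)
Lemma card_sumset_int (A B C : {fset int}) : A != fset0 -> B != fset0 ->
  (forall a b, a \in A -> b \in B -> (a + b \in C) && (a + b + 1 \in C)) ->
  (#|` A| + #|` B| <= #|` C|)%N.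
Proof.
move=> A0 B0 ABC.
have [a aA amax] := fset_argmax id A0.
have [b bB bmin] := fset_argmax (fun x => - x) B0.
rewrite -(card_translate A b) -(card_translate B (a + 1)) -cardfsUI.
rewrite (_ : _ `&` _ = fset0) ?cardfs0 ?addn0; last first.
  apply/fsetP => x; rewrite in_fsetI !mem_translate inE.
  by apply/negP => /andP[/amax + /bmin]; lia.
apply/fsubset_leq_card/fsubsetP => x; rewrite in_fsetU !mem_translate.
case/orP => xE.
  by have /andP[] := ABC _ _ xE bB; rewrite subrK.
by have /andP[_] := ABC _ _ aA xE; rewrite (_ : _ + 1 = x)//; ring.
Qed.

Variable R : realType.

(** A discrete layer-cake integral: for sorted p :: s and p <= x it telescopes to the distance from
    p to the last entry not above x. *)
Fixpoint layers (p : R) (s : seq R) (x : R) : R :=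
  if s is v :: s' then (v - p) * (v <= x)%R%:R + layers v s' x else 0.

Lemma layers_lt p s x : path <=%R p s -> x < p -> layers p s x = 0.
Proof.
elim: s p => //= v s IH p /andP[pv vs] xp.
have xv := lt_le_trans xp pv.
by rewrite leNgt xv mulr0 add0r IH.
Qed.

Lemma layers_le p s x : path <=%R p s -> p <= x -> layers p s x <= x - p.
Proof.
elim: s p => [|v s IH] p /=; first by rewrite subr_ge0.
move=> /andP[pv vs] px; case: (leP v x) => vx /=.
  by have := IH _ vs vx; lra.
by rewrite layers_lt //; lra.
Qed.

Lemma layers_eq p s x : path <=%R p s -> x \in p :: s -> layers p s x = x - p.
Proof.
elim: s p => [|v s IH] p; first by rewrite inE => _ /eqP->; rewrite subrr.
move=> /[dup] /= ps /andP[pv vs]; rewrite inE => /predU1P[xp|xs] /=.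
  case: (leP v x) => vx /=; last by rewrite layers_lt //; lra.
  have xv : x = v by apply/le_anti; rewrite vx xp pv.
  by rewrite IH ?xv ?mem_head // -xv xp; lra.
have vx : v <= x.
  move: xs; rewrite inE => /predU1P[->//|xs].
  by move: vs; rewrite (path_sortedE le_trans) => /andP[/allP/(_ _ xs)].
by rewrite vx IH //=; lra.
Qed.

(* Layer-cake comparison; only the levels attained by f or g matter. *)
Lemma sum_le_of_levels (I J K : {fset int}) (f g h : int -> R) :
  {in I, forall i, 0 <= f i <= 1} -> {in J, forall j, 0 <= g j <= 1} ->
  {in K, forall k, 0 <= h k} ->
  (forall l, l <= 1 -> (#|` [fset i in I | (l <= f i)%R]| +
     #|` [fset j in J | (l <= g j)%R]| <= #|` [fset k in K | (l <= h k)%R]|)%N) ->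
  \sum_(i <- I) f i + \sum_(j <- J) g j <= \sum_(k <- K) h k.
Proof.
move=> f01 g01 h0 lev.
pose s := sort <=%R ([seq f i | i <- I] ++ [seq g j | j <- J]).
have s01 : {in s, forall l, 0 <= l <= 1}.
  move=> l; rewrite mem_sort mem_cat => /orP[] /mapP[i iI ->].
    exact: f01.
  exact: g01.
have s_path : path <=%R 0 s.
  rewrite (path_sortedE le_trans) sort_sorted ?andbT; last exact: le_total.
  by apply/allP => l /s01/andP[].
have fE i : i \in I -> f i = layers 0 s (f i).
  move=> iI; rewrite layers_eq ?subr0 // inE mem_sort mem_cat.
  by rewrite (map_f f iI) /= orbT.
have gE j : j \in J -> g j = layers 0 s (g j).
  move=> jJ; rewrite layers_eq ?subr0 // inE mem_sort mem_cat.
  by rewrite (map_f g jJ) /= !orbT.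
rewrite (eq_big_seq (fun i => layers 0 s (f i)) fE).
rewrite (eq_big_seq (fun i => layers 0 s (g i)) gE).
apply: (@le_trans _ _ (\sum_(k <- K) layers 0 s (h k))); last first.
  rewrite big_seq [leRHS]big_seq; apply: ler_sum => k /h0 hk.
  by rewrite -[leRHS]subr0 layers_le.
have s1 : {in s, forall l, l <= 1} by move=> l /s01/andP[].
suff aux t p : path <=%R p t -> {in t, forall l, l <= 1} ->
    \sum_(i <- I) layers p t (f i) + \sum_(j <- J) layers p t (g j) <=
    \sum_(k <- K) layers p t (h k) by exact: aux.
elim: t p => [|v t IH] p /=; first by rewrite !big1_eq addr0.
move=> /andP[pv vt] t1; rewrite !big_split /= addrACA lerD //; last first.
  by apply: IH => // l lt; rewrite t1 // inE lt orbT.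
rewrite -!mulr_sumr -mulrDr ler_wpM2l ?subr_ge0 //.
rewrite -!natr_sum -natrD ler_nat -!card_sep; apply: lev.
by rewrite t1 ?mem_head.
Qed.

Lemma exists_root (n : nat) (x : R) : 0 < x -> (n = 0%N -> x = 1) ->
  exists2 y : R, 0 < y & y ^+ n = x.
Proof.
case: n => [|n] x0 nx; first by exists 1; rewrite ?nx.
exists (x `^ n.+1%:R^-1); first exact: powR_gt0.
by rewrite -powR_mulrn ?powR_ge0 // -powRrM mulVf ?pnatr_eq0 // powRr1 // ltW.
Qed.

(** The defect in the induction step is p (1 - p) (x - y) (x^n - y^n), a product of nonnegative
    terms up to a common sign. *)
Lemma expr_convex (n : nat) (p x y : R) : 0 <= p <= 1 -> 0 <= x -> 0 <= y ->
  (p * x + (1 - p) * y) ^+ n <= p * x ^+ n + (1 - p) * y ^+ n.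
Proof.
move=> /andP[p0 p1] x0 y0; elim: n => [|n IH]; first by rewrite !expr0; lra.
rewrite !exprS; set m := _ + _.
apply: (@le_trans _ _ (m * (p * x ^+ n + (1 - p) * y ^+ n))).
  by rewrite ler_wpM2l // addr_ge0 // mulr_ge0 // subr_ge0.
rewrite -subr_ge0 (_ : _ - _ = p * (1 - p) * ((x - y) * (x ^+ n - y ^+ n)));
  last by rewrite /m; ring.
apply: mulr_ge0; first by rewrite mulr_ge0 ?subr_ge0.
case: (leP x y) => xy.
  by apply: mulr_le0; rewrite subr_le0 ?lerXn2r.
by apply: mulr_ge0; rewrite subr_ge0 ?lerXn2r ?ltW.
Qed.

(** Convexity of the power at a/p and b/q with weights proportional to p and q. It removes the
    maxima p^n and q^n by which slice counts are normalised. *)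
Lemma bonnesen_ge (n : nat) (p q a b : R) : 0 < p -> 0 < q -> 0 <= a -> 0 <= b ->
  (a + b) ^+ n.+1 <=
    (p + q) ^+ n * (a ^+ n.+1 / p ^+ n + b ^+ n.+1 / q ^+ n).
Proof.
move=> p0 q0 a0 b0; have pq0 : 0 < p + q by exact: addr_gt0.
have r01 : 0 <= p / (p + q) <= 1.
  by rewrite divr_ge0 ?(ltW p0) ?(ltW pq0) //= ler_pdivrMr // mul1r lerDl ltW.
have := @expr_convex n.+1 (p / (p + q)) (a / p) (b / q) r01.
move=> /(_ (divr_ge0 a0 (ltW p0)) (divr_ge0 b0 (ltW q0))).
have -> : p / (p + q) * (a / p) + (1 - p / (p + q)) * (b / q) = (a + b) / (p + q).
  by field; rewrite !gt_eqF.
rewrite expr_div_n ler_pdivrMr ?exprn_gt0 // => /le_trans; apply.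
rewrite le_eqVlt; apply/orP; left; apply/eqP.
rewrite ![(_ / _) ^+ _]expr_div_n !exprS; field.
by rewrite !gt_eqF ?exprn_gt0.
Qed.

Definition cube n : {fset 'rV[int]_n} :=
  [fset \row_i (f i : nat)%:Z | f : {ffun 'I_n -> bool} in {: {ffun 'I_n -> bool}}].

Lemma mem_cubeP n (x : 'rV[int]_n) :
  reflect (forall i, x 0 i = 0 \/ x 0 i = 1) (x \in cube n).
Proof.
apply: (iffP (imfsetP _ _ _ _)) => /= [[f _ ->] i|x01].
  by rewrite mxE; case: (f i); [right | left].
exists [ffun i => x 0 i == 1] => //; apply/rowP => i.
by rewrite mxE ffunE; case: (x01 i) => ->.
Qed.

Definition row_cons n (i : int) (y : 'rV[int]_n) : 'rV[int]_n.+1 :=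
  \row_j (if unlift 0 j is Some k then y 0 k else i).

Definition row_tail n (x : 'rV[int]_n.+1) : 'rV[int]_n := \row_j x 0 (lift 0 j).

Lemma row_consK n i : cancel (@row_cons n i) (@row_tail n).
Proof. by move=> y; apply/rowP => j; rewrite !mxE liftK. Qed.

Lemma row_cons_head n i (y : 'rV[int]_n) : row_cons i y 0 0 = i.
Proof. by rewrite mxE unlift_none. Qed.

Lemma row_tailK n (x : 'rV[int]_n.+1) : row_cons (x 0 0) (row_tail x) = x.
Proof.
by apply/rowP => j; rewrite mxE; case: unliftP => [k|] ->; rewrite ?mxE.
Qed.

Lemma row_consD n i j (y z : 'rV[int]_n) :
  row_cons i y + row_cons j z = row_cons (i + j) (y + z).
Proof. by apply/rowP => k; rewrite !mxE; case: unlift => //= a; rewrite mxE. Qed.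

Definition slice n (X : {fset 'rV[int]_n.+1}) (i : int) : {fset 'rV[int]_n} :=
  [fset row_tail x | x in X & x 0 0 == i].

Definition heads n (X : {fset 'rV[int]_n.+1}) : {fset int} :=
  [fset (x : 'rV[int]_n.+1) 0 0 | x in X].

Lemma mem_slice n (X : {fset 'rV[int]_n.+1}) i y :
  (y \in slice X i) = (row_cons i y \in X).
Proof.
apply/imfsetP/idP => [[x] |yX].
  by rewrite !inE /= => /andP[xX /eqP <-] ->; rewrite row_tailK.
by exists (row_cons i y); rewrite ?row_consK // !inE /= yX row_cons_head eqxx.
Qed.

Lemma slice_neq0 n (X : {fset 'rV[int]_n.+1}) i :
  i \in heads X -> slice X i != fset0.
Proof.
move=> /imfsetP[x xX ->]; apply/fset0Pn; exists (row_tail x).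
by rewrite mem_slice row_tailK.
Qed.

Lemma card_slices n (X : {fset 'rV[int]_n.+1}) :
  (\sum_(i <- heads X) #|` slice X i| = #|` X|)%N.
Proof.
transitivity (\sum_(i <- heads X) \sum_(x <- X) (x 0%R 0%R == i)%R)%N.
  apply: eq_bigr => i _; rewrite -card_sep card_in_imfset /=.
    by rewrite [RHS]card_imfset.
  move=> x y; rewrite !unfold_in /= => /andP[_ /eqP xi] /andP[_ /eqP yi] xy.
  by rewrite -(row_tailK x) -(row_tailK y) xi yi xy.
rewrite exchange_big /= card_fset_sum1 [LHS]big_seq [RHS]big_seq.
apply: eq_bigr => x xX; rewrite -[RHS](cardfs1 (x 0 0)) -(@sum_mem _ (heads X)).
  by apply: eq_bigr => i _; rewrite inE eq_sym.
by rewrite fsub1set; apply/imfsetP; exists x.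
Qed.

(* Slice along the first coordinate and divide the slice counts of A and B by
   their maxima: by induction every superlevel set of the suitably normalised
   slice counts of the sum contains a one-dimensional sumset. *)
Lemma brunn_minkowski n (A B : {fset 'rV[int]_n}) (a b : R) :
  A != fset0 -> B != fset0 -> 0 <= a -> 0 <= b ->
  a ^+ n <= #|` A|%:R -> b ^+ n <= #|` B|%:R ->
  (a + b) ^+ n <= #|` sumset A (sumset B (cube n))|%:R.
Proof.
elim: n A B a b => [|n IH] A B a b A0 B0 a0 b0 aA bB.
  rewrite expr0 ler1n cardfs_gt0; apply/fset0Pn.
  have /fset0Pn[x xA] := A0; have /fset0Pn[y yB] := B0.
  exists (x + (y + 0)); do 2 apply: mem_sumset => //.
  by apply/mem_cubeP => -[].
set C := sumset A _.
pose F X i : R := #|` @slice n X i|%:R.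
have hd0 (X : {fset 'rV[int]_n.+1}) : X != fset0 -> heads X != fset0.
  by move=> /fset0Pn[x xX]; apply/fset0Pn; exists (x 0 0); apply/imfsetP; exists x.
have F_gt0 X i : i \in heads X -> 0 < F X i.
  by move=> iX; rewrite ltr0n cardfs_gt0 slice_neq0.
(* Only 1 has a zeroth root, so the passage from dimension 0 to 1 relies on slices being single
   points. *)
have F_dim0 X i : i \in heads X -> n = 0%N -> F X i = 1.
  move=> iX n0; apply/eqP; rewrite pnatr_eq1 eqn_leq cardfs_gt0 slice_neq0 // andbT.
  rewrite -[leqRHS](cardfs1 (0 : 'rV[int]_n)); apply/fsubset_leq_card/fsubsetP => x _.
  by apply/fset1P/rowP => k; have := ltn_ord k; rewrite {2}n0.
have norm X : X != fset0 -> exists2 M : R, 0 < M &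
    exists2 i, i \in heads X & M ^+ n = F X i /\ {in heads X, forall j, F X j <= M ^+ n}.
  move=> X0; have [i iX imax] := fset_argmax (F X) (hd0 _ X0).
  have [|M M0 ME] := @exists_root n (F X i) (F_gt0 _ _ iX).
    exact: F_dim0.
  by exists M => //; exists i => //; rewrite ME.
have [M M0 [i0 i0A [ME Mmax]]] := norm A A0.
have [N N0 [j0 j0B [NE Nmax]]] := norm B B0.
have MN0 : 0 < M + N by exact: addr_gt0.
have Fsum X : \sum_(i <- heads X) F X i = #|` X|%:R.
  by rewrite -natr_sum card_slices.
pose K := heads C.
(* The first coordinate e of the cube reaches both slices i + j and i + j + 1, as [card_sumset_int]
   requires. *)
have key i j e : i \in heads A -> j \in heads B -> e = 0 \/ e = 1 ->
    i + (j + e) \in K /\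
    Num.min (F A i / M ^+ n) (F B j / N ^+ n) <= F C (i + (j + e)) / (M + N) ^+ n.
  move=> iA jB e01; set l := Num.min _ _.
  have CS : sumset (slice A i) (sumset (slice B j) (cube n)) `<=` slice C (i + (j + e)).
    apply/fsubsetP => _ /mem_sumsetP[x xA [_ /mem_sumsetP[y yB [z zc ->]] ->]].
    rewrite mem_slice -!row_consD; apply: mem_sumset; first by rewrite -mem_slice.
    apply: mem_sumset; first by rewrite -mem_slice.
    apply/mem_cubeP => k; rewrite mxE; case: unlift => [k'|//].
    exact: (mem_cubeP _ zc).
  have l0 : 0 < l by rewrite lt_min !divr_gt0 ?exprn_gt0 ?F_gt0.
  (* Scaling M and N by the same m keeps both below the roots of the slice sizes, so the induction
     hypothesis yields a multiple of (M + N)^n. *)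
  have [|m m0 mE] := @exists_root n l l0.
    by move=> n0; rewrite /l !F_dim0 // n0 !expr0 divr1 minxx.
  have H : ((m * M) + (m * N)) ^+ n <= F C (i + (j + e)).
    apply: le_trans (IH (slice A i) (slice B j) (m * M) (m * N) _ _ _ _ _ _) _;
      rewrite ?slice_neq0 ?mulr_ge0 ?(ltW m0) ?(ltW M0) ?(ltW N0) // ?exprMn ?mE.
    - by rewrite -ler_pdivlMr ?exprn_gt0 // ge_min lexx.
    - by rewrite -ler_pdivlMr ?exprn_gt0 // ge_min lexx orbT.
    - by rewrite ler_nat fsubset_leq_card.
  split; last by rewrite ler_pdivlMr ?exprn_gt0 // -mE -exprMn mulrDr.
  have : 0 < F C (i + (j + e)) by apply: lt_le_trans H; rewrite exprn_gt0 // -mulrDr mulr_gt0.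
  rewrite ltr0n cardfs_gt0 => /fset0Pn[y]; rewrite mem_slice => yC.
  by apply/imfsetP; exists (row_cons (i + (j + e)) y); rewrite ?row_cons_head.
have MN1 : \sum_(i <- heads A) F A i / M ^+ n + \sum_(j <- heads B) F B j / N ^+ n <=
    \sum_(k <- K) F C k / (M + N) ^+ n.
  apply: sum_le_of_levels.
  - move=> i iA; rewrite divr_ge0 ?exprn_ge0 ?(ltW M0) ?(ltW (F_gt0 _ _ iA)) //=.
    by rewrite ler_pdivrMr ?exprn_gt0 // mul1r Mmax.
  - move=> j jB; rewrite divr_ge0 ?exprn_ge0 ?(ltW N0) ?(ltW (F_gt0 _ _ jB)) //=.
    by rewrite ler_pdivrMr ?exprn_gt0 // mul1r Nmax.
  - by move=> k _; rewrite divr_ge0 ?ler0n ?exprn_ge0 ?(ltW MN0).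
  (* Both maxima are normalised to 1, so the superlevel sets are nonempty for every l <= 1. *)
  move=> l l1; apply: card_sumset_int.
  - apply/fset0Pn; exists i0; rewrite !inE /= i0A -ME divff ?l1 //.
    by rewrite expf_neq0 // gt_eqF.
  - apply/fset0Pn; exists j0; rewrite !inE /= j0B -NE divff ?l1 //.
    by rewrite expf_neq0 // gt_eqF.
  move=> i j; rewrite !inE /= => /andP[iA li] /andP[jB lj].
  have [] := key i j 0 iA jB (or_introl erefl); rewrite addr0 => ij0 f0.
  have [ij1 f1] := key i j 1 iA jB (or_intror erefl).
  rewrite -addrA ij0 ij1 /= (le_trans _ f0) ?(le_trans _ f1) //.
    by rewrite le_min li lj.
  by rewrite le_min li lj.
move: MN1; rewrite -!mulr_suml !Fsum ler_pdivlMr ?exprn_gt0 // => /(le_trans _); apply.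
apply: le_trans (bonnesen_ge n M0 N0 a0 b0) _.
rewrite mulrC ler_wpM2r ?exprn_ge0 ?(ltW MN0) //.
by apply: lerD; rewrite ler_wpM2r // invr_ge0 exprn_ge0 // ltW.
Qed.

End BrunnMinkowski.

(** * Monotonicity and a lower bound for the edge boundary *)

Section Bounds.
Local Open Scope fset_scope.
Local Open Scope ring_scope.

Definition sqnorm d (x : 'rV[int]_d) : int := \sum_i x 0 i ^+ 2.

Lemma sqnorm_parallelogram d (x u : 'rV[int]_d) :
  sqnorm (x + u) + sqnorm (x - u) = 2 * sqnorm x + 2 * sqnorm u.
Proof.
rewrite /sqnorm !mulr_sumr -!big_split; apply: eq_bigr => i _ /=.
by rewrite !mxE; ring.
Qed.

Lemma sqnorm_gt0 d (u : 'rV[int]_d) : u != 0 -> 0 < sqnorm u.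
Proof.
move=> u0; rewrite lt_neqAle sumr_ge0 ?andbT; last by move=> i _; exact: sqr_ge0.
apply: contra_neq u0 => /esym/eqP; rewrite psumr_eq0 => [/allP u0|i _]; last exact: sqr_ge0.
by apply/rowP => i; apply/eqP; rewrite mxE -sqrf_eq0 (implyP (u0 i _)) ?mem_index_enum.
Qed.

(* By the parallelogram identity a point of maximal norm cannot have both
   neighbours x + u and x - u in S, so deleting it loses at least as many
   boundary edges in direction u as it creates. *)
Lemma edge_boundary_remove d (U S : {fset 'rV[int]_d}) : 0 \notin U ->
  S != fset0 ->
  exists2 x, x \in S & (edge_boundary U (S `\ x) <= edge_boundary U S)%N.
Proof.
move=> U0 S0; have [x xS xmax] := fset_argmax (@sqnorm d) S0.
exists x => //; rewrite !edge_boundaryE big_seq [leqRHS]big_seq.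
apply: leq_sum => u uU; rewrite !card_leaving.
have u0 : u != 0 by apply/eqP => E; rewrite E (negPf U0) in uU.
have [xuS|xuS] := boolP (x + u \in S); last first.
  rewrite [leqRHS](cardfsD1 x) !inE /= xS xuS /= add1n.
  set T := [fset y in S | y + u \notin S]; apply: (@leq_trans #|` (x - u) |` (T `\ x)|).
    apply/fsubset_leq_card/fsubsetP => y; rewrite !inE /= => /andP[/andP[yx yS]].
    rewrite yx yS /= negb_and negbK => /orP[/eqP <-|->]; last by rewrite orbT.
    by rewrite addrK eqxx.
  by rewrite cardfsU1; exact: leq_add (leq_b1 _) (leqnn _).
apply/fsubset_leq_card/fsubsetP => y; rewrite !inE /= => /andP[/andP[yx yS]].
rewrite yS negb_and negbK => /orP[/eqP yE|//].
exfalso; have := sqnorm_parallelogram x u; have := xmax _ xuS.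
have := sqnorm_gt0 u0; have : sqnorm (x - u) <= sqnorm x.
  by apply: xmax; rewrite -yE addrK.
move: (sqnorm _) (sqnorm _) (sqnorm _) (sqnorm _) => p q r s H1 H2 H3 H4.
have := lerD H3 H1; rewrite H4; lia.
Qed.

(** Points of S are deleted one by one, never increasing the boundary, until exactly n are left. *)
Lemma edge_isoperimetry_le d (U S : {fset 'rV[int]_d}) n : (0 < d)%N ->
  0 \notin U -> (n <= #|` S|)%N ->
  (edge_isoperimetry U n <= edge_boundary U S)%N.
Proof.
move=> d0 U0; have [_ iso_le] := edge_isoperimetryP U n d0.
move: {2}(#|` S| - n)%N (erefl (#|` S| - n)%N) => k.
elim: k S => [|k IH] S Sk nS.
  by apply: iso_le; apply/eqP; rewrite eqn_leq nS andbT; lia.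
have [|x xS] := @edge_boundary_remove d U S U0.
  by rewrite -cardfs_gt0; lia.
apply: leq_trans; have := cardfsD1 x S; rewrite xS add1n => SE.
by apply: IH; lia.
Qed.

Lemma sum_multiset (V : zmodType) (U : {fset V}) m (F : V -> nat) :
  (\sum_(w <- flatten (nseq m (enum_fset U))) F w = m * \sum_(w <- U) F w)%N.
Proof.
by elim: m => [|m IH] /=; rewrite ?big_nil // big_cat /= IH mulSn.
Qed.

Lemma edge_boundary_multiset (V : zmodType) (U S : {fset V}) m :
  (\sum_(w <- flatten (nseq m (enum_fset U))) #|` leaving S w|
    = m * edge_boundary U S)%N.
Proof. by rewrite sum_multiset edge_boundaryE. Qed.

Variable R : realType.

(** Keeps the two leading binomial terms; this linearises the Brunn-Minkowski bound. *)
Lemma expr_tangent (n : nat) (x y : R) : 0 <= x -> 0 <= y ->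
  x ^+ n.+1 + n.+1%:R * y * x ^+ n <= (x + y) ^+ n.+1.
Proof.
move=> x0 y0; elim: n => [|n IH]; first by rewrite !expr1 expr0; lra.
rewrite [leRHS]exprS; apply: (@le_trans _ _ ((x + y) * (x ^+ n.+1 + n.+1%:R * y * x ^+ n))).
  rewrite -subr_ge0 [X in 0 <= X](_ : _ = n.+1%:R * y ^+ 2 * x ^+ n).
    by rewrite !mulr_ge0 ?exprn_ge0 ?ler0n.
  by rewrite [n.+2%:R]mulrS !exprS; ring.
by rewrite ler_wpM2l ?addr_ge0.
Qed.

(** Quantitative form of the lower bound: c copies of Z_0 absorb the cube in Brunn-Minkowski, a is
    at most the root of the size of the remaining m - c copies, and k bounds the root of the size of
    S + rZ_0, hence of every level set. *)
Lemma edge_boundary_ge d (U : {fset 'rV[int]_d.+1}) : generates U ->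
  exists c, forall (S : {fset 'rV[int]_d.+1}) (r m : nat) (a k : R),
    (c <= m)%N -> 0 <= a -> a ^+ d.+1 <= #|` multiset_sums U (m - c)|%:R ->
    0 < k ->
    (#|` S| + #|` multiset_sums U r| * (r * edge_boundary U S))%:R <= k ^+ d.+1 ->
    d.+1%:R * a * (#|` multiset_sums U r| * #|` S|)%:R <=
      k * (#|` multiset_sums U (r + m)| * (m * edge_boundary U S))%:R.
Proof.
move=> Ugen; have [c [w cw]] := generates_multiset_sums (cube d.+1) Ugen.
exists c => S r m a k cm a0 aZ k0 Sk.
set Q := multiset_sums U r in Sk *; set P := multiset_sums U _.
have cardF (F : {fset 'rV[int]_d.+1}) : F `<=` sumset S Q ->
    d.+1%:R * a * #|` F|%:R <= k * (#|` sumset F (multiset_sums U m)|%:R - #|` F|%:R).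
  move=> FSQ.
  have [->|F0] := eqVneq F fset0.
    rewrite cardfs0 mulr0 mulr_ge0 ?subr_ge0 ?ler0n // ltW //.
  have [||al al0 alE] := @exists_root R d.+1 #|` F|%:R.
  - by rewrite ltr0n cardfs_gt0.
  - by [].
  have BM : (al + a) ^+ d.+1 <= #|` sumset F (multiset_sums U m)|%:R.
    apply: le_trans (brunn_minkowski (B := multiset_sums U (m - c)) F0 _ (ltW al0) a0 _ aZ) _.
    - by apply/fset0Pn; exists 0; exact: multiset_sums_mem0.
    - by rewrite alE.
    rewrite ler_nat -(card_translate _ w); apply/fsubset_leq_card/fsubsetP => x.
    rewrite mem_translate => /mem_sumsetP[y yF [_ /mem_sumsetP[z zZ [q qc ->]] xE]].
    rewrite -(subnK cm) multiset_sumsD -[x](subrK w) xE -!addrA.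
    by do 2 apply: mem_sumset => //; exact: cw.
  have alk : al <= k.
    rewrite -(@ler_pXn2r _ d.+1) ?nnegrE ?(ltW al0) ?(ltW k0) // alE.
    apply: le_trans Sk; rewrite ler_nat (leq_trans (fsubset_leq_card FSQ)) //.
    by rewrite (leq_trans (card_sumset_le _ _)) // edge_boundary_multiset.
  (* Trading one factor [al] for [k] makes the left side linear in |F|, so that it can be summed
     over the levels. *)
  apply: (@le_trans _ _ (k * (d.+1%:R * a * al ^+ d))).
    rewrite -alE exprS (mulrCA k) ler_wpM2l ?mulr_ge0 ?ler0n //.
    by rewrite ler_wpM2r // exprn_ge0 // ltW.
  rewrite ler_wpM2l ?(ltW k0) // lerBrDl (le_trans _ BM) // -alE.
  by rewrite expr_tangent // ltW.
have /(@ler_sum _ _ (index_enum 'I_#|` Q|) predT) : forall l : 'I_#|` Q|, true ->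
    d.+1%:R * a * #|` level_set Q S l|%:R <=
    k * (#|` sumset (level_set Q S l) (multiset_sums U m)|%:R - #|` level_set Q S l|%:R).
  by move=> l _; apply: cardF; apply/fsubsetP => x; rewrite !inE /= => /andP[].
rewrite -!mulr_sumr -natr_sum sum_level_set => /le_trans; apply.
rewrite ler_wpM2l ?(ltW k0) // sumrB -!natr_sum sum_level_set lerBlDl -natrD ler_nat.
rewrite -[(m * _)%N]edge_boundary_multiset; apply: sum_level_set_sumset.
by rewrite -multiset_sumsD.
Qed.

End Bounds.

(** * Lattice points of dilated zonotopes *)

Section ZonotopeSums.
Local Open Scope fset_scope.
Local Open Scope ring_scope.

Lemma seq_sumsP (V : zmodType) (ws : seq V) z : uniq ws -> z \in seq_sums ws ->
  exists2 b : V -> nat, forall u, (b u <= 1)%N & z = \sum_(u <- ws) u *+ b u.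
Proof.
elim: ws z => [|w ws IH] z /=.
  by rewrite seq_sums_nil => _ /fset1P ->; exists (fun=> 0%N); rewrite ?big_nil.
move=> /andP[wws uws]; rewrite seq_sums_cons => /mem_sumsetP[a aw [y yws ->]].
have [b b1 ->] := IH y uws yws.
exists (fun u => if u == w then (a == w) : nat else b u).
  by move=> u; case: eqP => // _; case: (a == w).
rewrite big_cons eqxx; congr (_ + _).
  move: aw; rewrite !inE => /orP[] /eqP ->; last by rewrite eqxx.
  by case: eqP => [<-|]; rewrite ?mul0rn ?mulr0n.
apply: eq_big_seq => u uws'; case: eqP => // uw.
by move: wws; rewrite -uw uws'.
Qed.

Lemma mem_seq_sums (V : zmodType) (ws : seq V) (b : V -> nat) :
  (forall u, (b u <= 1)%N) -> \sum_(u <- ws) u *+ b u \in seq_sums ws.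
Proof.
move=> b1; elim: ws => [|w ws IH]; first by rewrite big_nil seq_sums_nil fset11.
rewrite big_cons seq_sums_cons; apply: mem_sumset => //; rewrite !inE.
by have := b1 w; case: (b w) => [|[|//]] _; rewrite ?mulr0n ?mulr1n eqxx ?orbT.
Qed.

Lemma multiset_sumsP (V : zmodType) (U : {fset V}) j z :
  reflect (exists2 c : V -> nat, forall u, (c u <= j)%N & z = \sum_(u <- U) u *+ c u)
    (z \in multiset_sums U j).
Proof.
apply: (iffP idP) => [|[c cj ->]].
- elim: j z => [|j IH] z.
    rewrite /multiset_sums seq_sums_nil => /fset1P ->.
    by exists (fun=> 0%N) => //; rewrite big1.
  rewrite -[j.+1]addn1 multiset_sumsD => /mem_sumsetP[x /IH[c cj ->] [y yU ->]].
  move: yU; rewrite /multiset_sums /= cats0 => /(seq_sumsP (fset_uniq _))[b b1 ->].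
  exists (fun u => c u + b u)%N; first by move=> u; exact: leq_add.
  by rewrite -big_split; apply: eq_bigr => u _; rewrite mulrnDr.
elim: j c cj => [|j IH] c cj.
  rewrite big1 ?multiset_sums_mem0 // => u _.
  by move: (cj u); rewrite leqn0 => /eqP ->; rewrite mulr0n.
(* One copy of Z_0 takes min(c u, 1) of each u, which leaves coefficients at most j. *)
rewrite (_ : \sum_(u <- U) _ =
  \sum_(u <- U) u *+ (c u).-1 + \sum_(u <- U) u *+ minn (c u) 1).
  rewrite -[j.+1]addn1 multiset_sumsD; apply: mem_sumset.
    by apply: IH => u; have := cj u; lia.
  rewrite /multiset_sums /= cats0; apply: mem_seq_sums => u; exact: geq_minr.
rewrite -big_split; apply: eq_bigr => u _ /=; rewrite -mulrnDr.
by congr (_ *+ _); lia.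
Qed.

Variables (R : realType) (d : nat).
Implicit Types (U : {fset 'rV[int]_d}).
Local Notation iv := (@int_vec R d).

Lemma int_vec_additive : {morph iv : x y / x - y}.
Proof. by move=> x y; apply/rowP => i; rewrite !mxE rmorphB. Qed.

HB.instance Definition _ := GRing.isZmodMorphism.Build _ _ iv int_vec_additive.

(** For positive t this is tZ, presented as the linear image of the cube [0,t]^U. *)
Definition zonotope_sums U (t : R) : set 'rV[R]_d :=
  [set x | exists2 s : 'rV[int]_d -> R,
     forall u, 0 <= s u <= t & x = \sum_(u <- U) s u *: iv u].

Lemma zonotope_sums_convex U t x y l : 0 <= l <= 1 ->
  zonotope_sums U t x -> zonotope_sums U t y ->
  zonotope_sums U t (l *: x + (1 - l) *: y).
Proof.
move=> /andP[l0 l1] [s st ->] [r rt ->]; exists (fun u => l * s u + (1 - l) * r u).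
  move=> u; have /andP[? ?] := st u; have /andP[? ?] := rt u.
  by apply/andP; split; nra.
rewrite !scaler_sumr -big_split; apply: eq_bigr => u _ /=.
by rewrite !scalerA -scalerDl.
Qed.

Lemma zonotope_sumsD U t r x y : zonotope_sums U t x -> zonotope_sums U r y ->
  zonotope_sums U (t + r) (x + y).
Proof.
move=> [s st ->] [q qr ->]; exists (fun u => s u + q u).
  move=> u; have /andP[? ?] := st u; have /andP[? ?] := qr u.
  by rewrite addr_ge0 // lerD.
by rewrite -big_split; apply: eq_bigr => u _; rewrite scalerDl.
Qed.

Lemma zonotope_sumsZ U t r x : 0 <= t -> zonotope_sums U r x ->
  zonotope_sums U (t * r) (t *: x).
Proof.
move=> t0 [s sr ->]; exists (fun u => t * s u).
  by move=> u; have /andP[? ?] := sr u; rewrite mulr_ge0 // ler_wpM2l.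
by rewrite scaler_sumr; apply: eq_bigr => u _; rewrite scalerA.
Qed.

(** The image of the cube is convex and contains Z_0. Conversely, inside any convex set containing
    Z_0 the coefficients can be made fractional one generator at a time. *)
Lemma zonotopeE U : zonotope R U = zonotope_sums U 1.
Proof.
apply/seteqP; split => x.
  apply: smallest_sub => [y z l yU zU|_ /= [z zU <-]].
    rewrite inE; apply: zonotope_sums_convex (set_mem yU) (set_mem zU).
    by rewrite ge0 le1.
  move: zU; rewrite -multiset_sums1 => /multiset_sumsP[c c1 ->].
  exists (fun u => (c u)%:R); first by move=> u; rewrite ler0n lern1 c1.
  by rewrite raddf_sum; apply: eq_bigr => u _; rewrite raddfMn scaler_nat.
move=> [s s01 ->] A [/= Aconv AU].
(* The base point is arbitrary so that the induction hypothesis applies at both ends y and y + w of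
   the segment in direction w. *)
suff aux ws (y : 'rV[R]_d) : {in seq_sums ws, forall z, A (y + iv z)} ->
    A (y + \sum_(u <- ws) s u *: iv u).
  rewrite -[X in A X]add0r; apply: aux => z zU.
  by rewrite add0r; apply: AU; exists z.
elim: ws y => [|w ws IH] y yA.
  by rewrite big_nil; have := yA 0 (seq_sums0 _); rewrite raddf0.
rewrite big_cons.
have A0 : A (y + \sum_(u <- ws) s u *: iv u).
  apply: IH => z zws; apply: yA; rewrite seq_sums_cons -[z]add0r.
  by apply: mem_sumset => //; rewrite !inE eqxx.
have A1 : A (y + iv w + \sum_(u <- ws) s u *: iv u).
  apply: IH => z zws; rewrite -addrA -raddfD; apply: yA; rewrite seq_sums_cons.
  by apply: mem_sumset => //; rewrite !inE eqxx orbT.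
have /andP[s0 s1] := s01 w.
have := Aconv _ _ (Itv01 s0 s1) (mem_set A1) (mem_set A0) => /set_mem /=.
congr (A _).
rewrite /conv /= /unstable.onem; move: (\sum_(u <- ws) _) => S.
by apply/rowP => i; rewrite !mxE; ring.
Qed.

Lemma dilation_zonotopeE U t : 0 < t ->
  dilation t (zonotope R U) = zonotope_sums U t.
Proof.
move=> t0; rewrite zonotopeE; apply/seteqP; split => [_ [x xU <-]|x xU].
  by rewrite -[t in zonotope_sums _ t]mulr1; apply: zonotope_sumsZ => //; exact: ltW.
exists (t^-1 *: x); last by rewrite scalerA divff ?scale1r // gt_eqF.
rewrite -(mulVf (lt0r_neq0 t0)); apply: zonotope_sumsZ => //.
by rewrite invr_ge0 ltW.
Qed.

Lemma zonotope_sums_lattice U j p : p \in multiset_sums U j ->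
  zonotope_sums U j%:R (iv p).
Proof.
move=> /multiset_sumsP[c cj ->]; exists (fun u => (c u)%:R).
  by move=> u; rewrite ler0n ler_nat cj.
by rewrite raddf_sum; apply: eq_bigr => u _; rewrite raddfMn scaler_nat.
Qed.

Lemma finite_box (B : nat) : exists F : {fset 'rV[int]_d},
  forall y : 'rV[int]_d, (forall i, `|y 0 i| <= B%:Z) -> y \in F.
Proof.
exists [fset \row_i ((f i : nat)%:Z - B%:Z) |
  f : {ffun 'I_d -> 'I_(B + B).+1} in {: {ffun 'I_d -> 'I_(B + B).+1}}].
move=> y yB; apply/imfsetP => /=.
exists [ffun i => inord (absz (y 0 i + B%:Z))] => //.
apply/rowP => i; rewrite mxE ffunE; have := yB i; rewrite ler_norml => /andP[].
move: (y 0 i) => k k1 k2.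
by rewrite inordK; lia.
Qed.

Definition floor_vec (x : 'rV[R]_d) : 'rV[int]_d := \row_i Num.floor (x 0 i).

Lemma floor_vec_int p : floor_vec (iv p) = p.
Proof. by apply/rowP => i; rewrite !mxE intrKfloor. Qed.

(* Write x as an integer combination of U plus a fractional remainder; the
   floor of x then differs from the former by a lattice point of bounded size,
   which is absorbed by finitely many further copies of U. *)
Lemma zonotope_sums_floor U : generates U ->
  exists c w, forall j t x, t < j.+1%:R -> zonotope_sums U t x ->
    floor_vec x + w \in multiset_sums U (j + c).
Proof.
move=> Ugen.
pose B := (\sum_(u <- U) \sum_i absz (u 0%R i))%N.
have [F FP] := finite_box B.+1.
have [c [w cw]] := generates_multiset_sums F Ugen.
exists c, w => j t x tj [s st xE].
pose z := \sum_(u <- U) u *+ Num.truncn (s u).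
have zU : z \in multiset_sums U j.
  apply/multiset_sumsP; exists (fun u => Num.truncn (s u)) => // u.
  have /andP[s0 sjt] := st u.
  by rewrite -ltnS truncn_lt_nat // (le_lt_trans sjt).
rewrite multiset_sumsD (_ : _ + w = z + (floor_vec x - z + w)); last first.
  by rewrite addrA addrCA subrr addr0.
apply: mem_sumset => //; apply: cw; apply: FP => i.
have xi : x 0 i = \sum_(u <- U) s u * (u 0 i)%:~R.
  by rewrite xE summxE; apply: eq_bigr => u _; rewrite !mxE.
have zi : (z 0 i)%:~R = \sum_(u <- U) (Num.truncn (s u))%:R * (u 0 i)%:~R :> R.
  rewrite /z summxE rmorph_sum; apply: eq_bigr => u _.
  by rewrite mulmxnE rmorphMn mulr_natl.
have fr : `|x 0 i - (z 0 i)%:~R| <= B%:R.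
  rewrite xi zi -sumrB (le_trans (ler_norm_sum _ _ _)) // /B natr_sum.
  apply: ler_sum => u _; rewrite -mulrBl normrM.
  apply: (@le_trans _ _ `|(u 0 i)%:~R|).
    rewrite ler_piMl //; have /andP[s0 _] := st u.
    have := truncn_itv s0; rewrite -natr1 => /andP[h1 h2].
    by rewrite ger0_norm; lra.
  rewrite -intr_norm -abszE -pmulrn ler_nat (bigD1 i) //=; exact: leq_addr.
have := floor_itv (x 0 i); rewrite intrD => /andP[f1 f2].
rewrite -(ler_int R) !mxE intr_norm rmorphB /= ler_norml.
move: fr; rewrite ler_norml => /andP[g1 g2].
have -> : (B.+1%:Z)%:~R = B%:R + 1 :> R by rewrite -pmulrn natr1.
by apply/andP; split; lra.
Qed.

(** A lattice point is its own floor, so [zonotope_sums_floor] puts all lattice points of tZ in a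
    translate of (j + c)Z_0; this gives finiteness together with the upper count. *)
Lemma lattice_zonotope U : generates U ->
  exists c, forall j t, 0 < t -> j%:R <= t < j.+1%:R ->
    exists2 S : {fset 'rV[int]_d},
      [set` S]%classic = lattice_points (dilation t (zonotope R U)) &
      (#|` multiset_sums U j| <= #|` S| <= #|` multiset_sums U (j + c)|)%N.
Proof.
move=> Ugen; have [c [w cw]] := zonotope_sums_floor Ugen; exists c.
move=> j t t0 /andP[jt tj]; rewrite dilation_zonotopeE //.
pose T := translate (multiset_sums U (j + c)) (- w).
have inT p : zonotope_sums U t (iv p) -> p \in T.
  by move=> /(cw _ _ _ tj); rewrite floor_vec_int mem_translate opprK.
pose S := [fset p in T | `[< zonotope_sums U t (iv p) >]].
have SE p : p \in S = `[< zonotope_sums U t (iv p) >].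
  by rewrite !inE /=; apply: andb_idl => /asboolP; exact: inT.
exists S; first by apply/seteqP; split => p /=; rewrite SE => /asboolP.
apply/andP; split.
  apply/fsubset_leq_card/fsubsetP => p /zonotope_sums_lattice [s sj pE].
  rewrite SE; apply/asboolP; exists s => // u.
  by have /andP[-> sju] := sj u; rewrite (le_trans sju).
rewrite -(card_translate _ (- w)); apply/fsubset_leq_card/fsubsetP => p.
by rewrite SE => /asboolP /inT.
Qed.

Lemma lattice_zonotope_convex U t (S : {fset 'rV[int]_d}) u : 0 < t ->
  [set` S]%classic = lattice_points (dilation t (zonotope R U)) ->
  convex_along S u.
Proof.
move=> t0; rewrite dilation_zonotopeE // => SE x k.
have SP p : p \in S <-> zonotope_sums U t (iv p).
  by have : [set` S]%classic p <-> zonotope_sums U t (iv p) by rewrite SE.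
move=> /SP xS /SP xkS; apply/SP.
(* The point x + u divides the segment from x to x + (k + 1) u with weight 1/(k + 1) at the far
   end. *)
have k01 : 0 <= (k.+1%:R^-1 : R) <= 1.
  by rewrite invr_ge0 ler0n invf_le1 ?ltr0n // ler1n.
have := zonotope_sums_convex k01 xkS xS; congr (zonotope_sums _ _ _).
apply/rowP => i; rewrite !mxE mulmxnE !intrD rmorphMn /= -mulr_natr.
by field; rewrite ?natr1 ?nat1r pnatr_eq0.
Qed.

(** T contains S + mZ_0, and [card_sumset_convex] counts the gain from each of the m copies of U. *)
Lemma lattice_zonotope_boundary U t m (S T : {fset 'rV[int]_d}) :
  0 \notin U -> 0 < t ->
  [set` S]%classic = lattice_points (dilation t (zonotope R U)) ->
  [set` T]%classic = lattice_points (dilation (t + m%:R) (zonotope R U)) ->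
  (#|` S| + m * edge_boundary U S <= #|` T|)%N.
Proof.
move=> U0 t0 SE TE; rewrite -edge_boundary_multiset.
apply: leq_trans (card_sumset_convex _) _ => [w wU|].
  split; last exact: lattice_zonotope_convex t0 SE.
  have w0 : w != 0.
    apply/eqP => w0; move: wU; rewrite w0 => /flattenP[s /nseqP[-> _]].
    exact/negP.
  move=> k; apply: contraNneq w0 => /rowP wk; apply/eqP/rowP => i.
  have := wk i; rewrite mulmxnE !mxE => /eqP; rewrite -mulr_natr mulf_eq0.
  by rewrite natz /= orbF => /eqP.
apply/fsubset_leq_card/fsubsetP => _ /mem_sumsetP[x xS [y yU ->]].
have : [set` T]%classic (x + y); last by [].
rewrite TE /lattice_points /= dilation_zonotopeE ?ltr_wpDr ?ler0n //.
rewrite raddfD; apply: zonotope_sumsD; last exact: zonotope_sums_lattice.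
have : [set` S]%classic x by [].
by rewrite SE /lattice_points /= dilation_zonotopeE.
Qed.

End ZonotopeSums.

(** * Volume of the zonotope *)

Section Volume.
Import numFieldNormedType.Exports.
Local Open Scope fset_scope.
Local Open Scope classical_set_scope.
Local Open Scope ring_scope.

Variable R : realType.

Lemma lebesgue_outer_ge0 d (A : set 'rV[R]_d) : (0 <= lebesgue_outer A)%E.
Proof.
apply: le_ereal_inf_tmp => _ [a [b [ab _ ->]]].
apply: nneseries_ge0 => k _ _; rewrite lee_fin; apply: prodr_ge0 => i _.
by rewrite subr_ge0.
Qed.

Lemma lebesgue_outer_le d (A : set 'rV[R]_d) (K : choiceType) (s : seq K)
    (a b : K -> 'rV[R]_d) : (0 < d)%N ->
  (forall k i, a k 0 i <= b k 0 i) ->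
  (forall x, A x -> exists2 k, k \in s & closed_box (a k) (b k) x) ->
  (lebesgue_outer A <= (\sum_(k <- s) \prod_(i < d) (b k 0 i - a k 0 i))%:E)%E.
Proof.
move=> d0 ab cover.
(* Positions past the end of s receive the degenerate box at 0, of volume 0 because d > 0. *)
pose a' k := if onth s k is Some p then a p else 0.
pose b' k := if onth s k is Some p then b p else 0.
apply: ereal_inf_lbound; exists a', b'; split.
- by move=> k i; rewrite /a' /b'; case: onth => [p|//]; exact: ab.
- move=> x /cover[p ps xp]; exists (index p s) => //=.
  by rewrite /a' /b' onthE (nth_map p) ?index_mem // nth_index.
- rewrite (@nneseries_split _ _ 0 (size s)); last first.
    move=> k _; rewrite lee_fin; apply: prodr_ge0 => i _.
    by rewrite subr_ge0 /a' /b'; case: onth => [p|//]; exact: ab.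
  rewrite add0n eseries0 ?adde0; last first.
    move=> k sk _; rewrite /a' /b' onth_default //.
    rewrite (bigD1 (Ordinal d0)) //= subrr mul0r //.
  rewrite -sumEFin; case: s {cover} @a' @b' => [|p0 s] a' b'.
    by rewrite big_nil big_geq.
  rewrite [LHS](big_nth p0) big_nat_cond [RHS]big_nat_cond.
  apply: eq_bigr => k /andP[/andP[_ ks] _].
  by rewrite /a' /b' onthE (nth_map p0).
Qed.

(** The covering boxes have side 1/j and lowest corners (p - w)/j for p in (j + c)Z_0, since
    floor(jx) + w is such a p for every x in Z. *)
Lemma lebesgue_outer_zonotope d (U : {fset 'rV[int]_d.+1}) : generates U ->
  exists c, forall j, (0 < j)%N ->
    (lebesgue_outer (zonotope R U) <=
      (#|` multiset_sums U (j + c)|%:R / j%:R ^+ d.+1)%:E)%E.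
Proof.
move=> Ugen; have [c [w cw]] := zonotope_sums_floor R Ugen.
exists c => j j0; have jR : (0 : R) < j%:R by rewrite ltr0n.
pose a p : 'rV[R]_d.+1 := j%:R^-1 *: int_vec R (p - w).
pose b p : 'rV[R]_d.+1 := a p + const_mx j%:R^-1.
have ab p i : b p 0 i - a p 0 i = j%:R^-1
  by rewrite /b [X in X - _]mxE [const_mx _ _ _]mxE addrAC subrr add0r.
have -> : #|` multiset_sums U (j + c)|%:R / j%:R ^+ d.+1 =
    \sum_(p <- multiset_sums U (j + c)) \prod_(i < d.+1) (b p 0 i - a p 0 i).
  rewrite (eq_bigr (fun=> j%:R^-1 ^+ d.+1)).
    by rewrite big_const_seq count_predT iter_addr_0 -exprVn mulr_natl.
  move=> p _; rewrite (eq_bigr (fun=> j%:R^-1)) ?prodr_const ?card_ord //.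
apply: lebesgue_outer_le => // [p i|x].
  by rewrite -subr_ge0 ab invr_ge0 ltW.
rewrite zonotopeE => xU; exists (floor_vec (j%:R *: x) + w).
  apply: (cw j j%:R); first by rewrite ltr_nat.
  by rewrite -[X in zonotope_sums U X]mulr1; apply: zonotope_sumsZ => //; exact: ltW.
move=> i; rewrite !mxE addrK; have /andP[f1 f2] := floor_itv (j%:R * x 0 i).
rewrite ler_pdivrMl // f1 /= -[X in _ <= _ + X]mulr1 -mulrDr ler_pdivlMl //.
by move: f2; rewrite intrD => /ltW.
Qed.

Lemma prod_perturb (I : Type) (r : seq I) (F : I -> R) (e : R) :
  (forall i, 0 <= F i) -> 0 < e ->
  exists2 h, 0 < h & \prod_(i <- r) (F i + h) <= \prod_(i <- r) F i + e.
Proof.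
move=> F0; elim: r e => [|i r IH] e e0; first by exists 1; rewrite ?big_nil ?lerDl ?ltW.
have Fi := F0 i.
(* The error splits as F i * e1 + h' * (P + e1), each term at most e/2. *)
set e1 := e / (2 * (F i + 1)).
have e10 : 0 < e1 by rewrite divr_gt0 // mulr_gt0 // ltr_wpDl.
have [h h0] := IH e1 e10.
rewrite !big_cons; set P := \prod_(j <- r) F j => hle.
have P0 : 0 <= P by apply: prodr_ge0.
set h' := Num.min h (e / (2 * (P + e1))).
have h'0 : 0 < h' by rewrite lt_min h0 divr_gt0 // mulr_gt0 // ltr_wpDl.
exists h' => //; rewrite big_cons -/P.
apply: (@le_trans _ _ ((F i + h') * (P + e1))).
  apply: ler_wpM2l; first by rewrite addr_ge0 // ltW.
  apply: le_trans hle; apply: ler_prod => j _.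
  by rewrite addr_ge0 ?(ltW h'0) //= lerD2l ge_min lexx.
have h1 : h' * (P + e1) <= e / 2.
  have : h' <= e / (2 * (P + e1)) by rewrite ge_min lexx orbT.
  by rewrite ler_pdivlMr ?mulr_gt0 ?ltr_wpDl // => H; lra.
have h2 : F i * e1 <= e / 2.
  have : e1 * (2 * (F i + 1)) = e by rewrite divfK // mulf_neq0 // gt_eqF // ltr_wpDl.
  by move=> H; lra.
by lra.
Qed.

(** Offsets from the ceilings of the a i encode the points of F injectively. The common bound [M]
    gives all coordinates one finite codomain. *)
Lemma card_lattice_box d (F : {fset 'rV[int]_d}) (a b : 'I_d -> R) :
  (forall i, a i <= b i) ->
  {in F, forall p : 'rV[int]_d, forall i, a i <= (p 0 i)%:~R <= b i} ->
  #|` F|%:R <= \prod_(i < d) (b i - a i + 1).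
Proof.
move=> ab Fab.
pose n i := (Num.truncn (b i - a i)).+1.
pose M := (\max_i n i)%N.
pose phi (p : 'rV[int]_d) : {ffun 'I_d -> 'I_M.+1} :=
  [ffun i => inord (absz (p 0 i - Num.ceil (a i))%R)].
pose X : pred {ffun 'I_d -> 'I_M.+1} := family (fun i => [pred x : 'I_M.+1 | (x < n i)%N]).
have key p i : p \in F -> Num.ceil (a i) <= p 0 i /\
    (absz (p 0 i - Num.ceil (a i))%R < n i)%N.
  move=> /Fab/(_ i)/andP[ap pb].
  have ca : Num.ceil (a i) <= p 0 i by rewrite ceil_le_int.
  split=> //; rewrite ltnS truncn_ge_nat ?subr_ge0 // pmulrn abszE.
  rewrite ger0_norm ?subr_ge0 // rmorphB lerB // ceil_ge //.
have nM i : (n i <= M)%N by exact: leq_bigmax.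
have phi_inj : {in F &, injective phi}.
  move=> p q pF qF /ffunP pq; apply/rowP => i; have := congr1 val (pq i).
  have [p1 p2] := key p i pF; have [q1 q2] := key q i qF.
  have lt x : (x < n i)%N -> (x < M.+1)%N by move=> /leq_trans -> //; exact: leqW.
  rewrite !ffunE /= !inordK ?lt //; move: (p 0 i) (q 0 i) (Num.ceil _) p1 q1 => x y z.
  by lia.
have -> : #|` F| = #|` [fset phi p | p in F]| by rewrite card_in_imfset.
have le1 : (#|` [fset phi p | p in F]%fset| <= #|X|)%N.
  rewrite -card_finset; apply/fsubset_leq_card/fsubsetP => _ /imfsetP[p /= pF ->].
  rewrite inE /=; apply/familyP => i; rewrite inE ffunE.
  have [p1 p2] := key p i pF; rewrite inordK //.
  by rewrite (leq_trans p2) // ltnW // ltnS.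
apply: (@le_trans _ _ #|X|%:R); first by rewrite ler_nat.
rewrite card_family foldrE big_map big_enum /= natr_prod.
apply: ler_prod => i _; rewrite ler0n /=.
have -> : (#|[pred x : 'I_M.+1 | (x < n i)%N]| = n i)%N.
  rewrite -sum1_card big_mkcond /= -[RHS](minn_idPr (leqW (nM i))) -sum_ltn_ord.
  by apply: eq_bigr => x _; rewrite inE; case: ltnP.
by rewrite -natr1 lerD2r truncn_le subr_ge0.
Qed.

(** Z is a continuous image of a cube with one coordinate in [0,1] for each element of U. *)
Lemma zonotope_compact d (U : {fset 'rV[int]_d.+1}) : compact (zonotope R U).
Proof.
rewrite zonotopeE; set us := (enum_fset U : seq _).
pose f (v : 'rV[R]_(size us)) : 'rV[R]_d.+1 :=
  \sum_i v 0 i *: int_vec R (nth 0 us i).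
have -> : zonotope_sums U 1 =
    f @` [set v : 'rV[R]_(size us) | forall i, `[0, 1]%classic (v ord0 i)].
  apply/seteqP; split => [_ [s s01 ->]|_ [v v01 <-]].
    exists (\row_i s (nth 0 us i)) => [i /=|].
      by rewrite mxE in_itv /= s01.
    by rewrite [RHS](big_nth 0) big_mkord; apply: eq_bigr => i _; rewrite mxE.
  pose s u := if insub (index u us) is Some i then v 0 i else 0.
  exists s => [u|].
    rewrite /s; case: insubP => [i _ _|_]; last by rewrite lexx ler01.
    by have := v01 i; rewrite /= in_itv.
  rewrite [RHS](big_nth 0) big_mkord; apply: eq_bigr => i _.
  by rewrite /s index_uniq ?fset_uniq // valK.
apply: continuous_compact; last first.
  apply: (@rV_compact _ _ (fun=> `[0 : R, 1]%classic)) => i.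
  exact: segment_compact.
apply: continuous_subspaceT; apply: continuous_big => [|i _].
  exact: add_continuous.
move=> v; apply: cvgZr_tmp; first exact: nbhs_filter.
exact: (@coord_continuous R 1 _ 0 i v).
Qed.

Lemma sum_halves n : \sum_(0 <= k < n) (2^-1 : R) ^+ k.+1 <= 1.
Proof.
suff -> : \sum_(0 <= k < n) (2^-1 : R) ^+ k.+1 = 1 - 2^-1 ^+ n.
  by rewrite gerBl exprn_ge0 // invr_ge0.
elim: n => [|n IH]; first by rewrite big_geq // expr0 subrr.
by rewrite big_nat_recr //= IH !exprS; field.
Qed.

(** Enlarging the boxes at geometrically decreasing cost makes their interiors cover Z, and
    compactness leaves finitely many. The extra h in each side is room for rounding when lattice
    points are counted. *)
Lemma zonotope_cover d (U : {fset 'rV[int]_d.+1}) (v e : R) : 0 < e ->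
  (lebesgue_outer (zonotope R U) <= v%:E)%E ->
  exists (n : nat) (a b : nat -> 'rV[R]_d.+1) (h : R),
    [/\ 0 < h, forall k i, a k 0 i <= b k 0 i,
      zonotope R U `<=` [set x | exists2 k, (k < n)%N & closed_box (a k) (b k) x] &
      \sum_(0 <= k < n) \prod_(i < d.+1) (b k 0 i - a k 0 i + h) <= v + e].
Proof.
move=> e0 vU.
have e20 : 0 < e / 2 by rewrite divr_gt0.
have /ereal_inf_lt[_ [a [b [ab cov ->]]] sv] :
    (lebesgue_outer (zonotope R U) < (v + e / 2)%:E)%E.
  by apply: le_lt_trans vU _; rewrite lte_fin ltrDl.
have pert k : exists h, 0 < h /\
    \prod_(i < d.+1) (b k 0 i - a k 0 i + h) <=
    \prod_(i < d.+1) (b k 0 i - a k 0 i) + e / 2 * 2^-1 ^+ k.+1.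
  have [||h h0 hP] := @prod_perturb _ (index_enum 'I_d.+1)
    (fun i => b k 0 i - a k 0 i) (e / 2 * 2^-1 ^+ k.+1); last by exists h.
  - by move=> i; rewrite subr_ge0.
  - by rewrite mulr_gt0 // exprn_gt0 // invr_gt0.
have [h hP] := choice pert.
(* Two thirds of [h k] widen the box on its two sides; the last third is kept for the slack [m]. *)
pose g k := h k / 3.
have g0 k : 0 < g k by rewrite divr_gt0 //; have [] := hP k.
pose a' k : 'rV[R]_d.+1 := a k - const_mx (g k).
pose b' k : 'rV[R]_d.+1 := b k + const_mx (g k).
have := @zonotope_compact d U; rewrite compact_cover.
move=> /(_ nat setT (fun k => (closed_box (a' k) (b' k))°)) [||D _ Dcov].
- by move=> k _; exact: open_interior.
- move=> x /cov[k _ xk]; exists k => //; apply/nbhs_ballP; exists (g k) => //= y.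
  rewrite /ball /= /mx_ball => -[_ /(_ 0)] xy i; have /andP[x1 x2] := xk i.
  have := xy i; rewrite /ball /= ltr_norml => /andP[y1 y2].
  by rewrite !mxE; apply/andP; split; lra.
pose n := (\max_(k <- D) k).+1.
have [m m0 mg] : exists2 m : R, 0 < m & forall k, (k < n)%N -> m <= g k.
  elim: (n) => [|N [m m0 mg]]; first by exists 1.
  exists (Num.min m (g N)); first by rewrite lt_min m0 g0.
  move=> k; rewrite ltnS leq_eqVlt => /predU1P[->|/mg km].
    by rewrite ge_min lexx orbT.
  by rewrite ge_min km.
exists n, a', b', m; split => //.
- move=> k i; rewrite !mxE; have := ab k i; have := g0 k; lra.
- move=> x /Dcov[k kD /interior_subset xk]; exists k => //.
  by rewrite ltnS; apply: leq_bigmax_seq.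
have ser : \sum_(0 <= k < n) \prod_(i < d.+1) (b k 0 i - a k 0 i) <= v + e / 2.
  rewrite -lee_fin; apply: le_trans (ltW sv); rewrite -sumEFin.
  apply: nneseries_lim_ge => k _ _; rewrite lee_fin; apply: prodr_ge0 => i _.
  by rewrite subr_ge0.
apply: (@le_trans _ _ (\sum_(0 <= k < n) (\prod_(i < d.+1) (b k 0 i - a k 0 i)
    + e / 2 * 2^-1 ^+ k.+1))).
  rewrite big_nat [leRHS]big_nat; apply: ler_sum => k /andP[_ kn].
  have [_] := hP k; apply: le_trans; apply: ler_prod => i _.
  have := mg k kn; have := ab k i; have := g0 k; rewrite !mxE /g => ? ? ?.
  by apply/andP; split; lra.
rewrite big_split /= -mulr_sumr.
have := ler_wpM2l (ltW e20) (sum_halves n); lra.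
Qed.

(** Scaled by 1/j, the set jZ_0 lies in Z and hence in the finite cover. A box dilated by j holds at
    most the product of its sides plus 1, and that 1 is at most jh once j is large. *)
Lemma card_multiset_sums_le d (U : {fset 'rV[int]_d.+1}) (v e : R) : 0 < e ->
  (lebesgue_outer (zonotope R U) <= v%:E)%E ->
  exists J, forall j, (J <= j)%N ->
    #|` multiset_sums U j|%:R <= (v + e) * j%:R ^+ d.+1.
Proof.
move=> e0 /(zonotope_cover e0) [n [a [b [h [h0 ab cov sumle]]]]].
exists (Num.truncn h^-1).+1 => j Jj.
have j0 : (0 : R) < j%:R by rewrite ltr0n (leq_trans _ Jj).
have jh : 1 <= j%:R * h.
  rewrite -ler_pdivrMr // div1r ltW //; apply: lt_le_trans (truncnS_gt _) _.
  by rewrite ler_nat.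
pose B k := [fset p in multiset_sums U j |
  `[< closed_box (a k) (b k) (j%:R^-1 *: int_vec R p) >]].
have count : (#|` multiset_sums U j| <= \sum_(0 <= k < n) #|` B k|)%N.
  rewrite card_fset_sum1 (eq_bigr (fun k => \sum_(p <- multiset_sums U j) (p \in B k)))%N.
    rewrite exchange_big /= big_seq [leqRHS]big_seq; apply: leq_sum => p pU.
    have [|k kn kp] := cov (j%:R^-1 *: int_vec R p).
      have jV : 0 <= (j%:R^-1 : R) by rewrite invr_ge0 ltW.
      have := zonotope_sumsZ jV (zonotope_sums_lattice R pU).
      by rewrite zonotopeE mulVf // gt_eqF.
    rewrite big_mkord (bigD1 (Ordinal kn)) //= !inE /= pU /=.
    by have /asboolP -> := kp.
  move=> k _; rewrite sum_mem //; apply/fsubsetP => p.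
  by rewrite !inE => /andP[].
apply: (@le_trans _ _ (\sum_(0 <= k < n) #|` B k|%:R)).
  by rewrite -natr_sum ler_nat.
rewrite mulrC; apply: le_trans (ler_wpM2l _ sumle); last by rewrite exprn_ge0 // ltW.
rewrite mulr_sumr; apply: ler_sum => k _.
apply: le_trans (@card_lattice_box d.+1 (B k)
  (fun i => j%:R * a k 0 i) (fun i => j%:R * b k 0 i) _ _) _.
- by move=> i; rewrite ler_wpM2l // ltW.
- move=> p; rewrite !inE /= => /andP[_ pB] i; have /asboolP pk := pB; have := pk i.
  by rewrite !mxE ler_pdivlMl // ler_pdivrMl.
have -> : j%:R ^+ d.+1 = \prod_(i < d.+1) j%:R :> R by rewrite prodr_const card_ord.
rewrite -big_split /=.
apply: ler_prod => i _; have abi := ab k i.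
by apply/andP; split; nra.
Qed.

End Volume.

(** * Asymptotics *)

Section Asymptotics.
Local Open Scope fset_scope.
Local Open Scope ring_scope.
Variables (R : realType) (d : nat) (U : {fset 'rV[int]_d.+1}).
Hypothesis U_gen : generates U.
Local Notation N j := (#|` multiset_sums U j|).
Local Notation v := (vol (zonotope R U)).

Lemma expr_small (n : nat) (e : R) : 0 < e -> exists2 h, 0 < h & (1 + h) ^+ n <= 1 + e.
Proof.
move=> e0; have [h h0] := @prod_perturb R _ (index_enum 'I_n) (fun=> 1) e (fun=> ler01) e0.
by rewrite !prodr_const card_ord expr1n; exists h.
Qed.

Lemma expr_shift (n : nat) (k e : R) : 0 <= k -> 0 < e ->
  exists2 T, 0 < T & forall t, T <= t -> (t + k) ^+ n <= (1 + e) * t ^+ n.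
Proof.
move=> k0 e0; have e20 : 0 < e / 2 by rewrite divr_gt0.
have [h h0 he] := expr_small n e0.
exists (k / h + 1); first by rewrite ltr_wpDl // divr_ge0 // ltW.
move=> t Tt; have t0 : 0 < t.
  by apply: lt_le_trans Tt; rewrite ltr_wpDl // divr_ge0 // ltW.
have kt : k <= h * t.
  by rewrite mulrC -ler_pdivrMr //; lra.
apply: (@le_trans _ _ (((1 + h) * t) ^+ n)).
  by apply: lerXn2r; rewrite ?nnegrE; nra.
by rewrite exprMn ler_wpM2r // exprn_ge0 // ltW.
Qed.

(** A block of c copies of Z_0 contains a translated unit cube, so by Brunn-Minkowski each block
    raises the guaranteed root of the count by 1. This serves to show that Z has positive volume. *)
Lemma multiset_sums_growth : exists2 c, (0 < c)%N &
  forall j, (j ^ d.+1 <= N (j * c))%N.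
Proof.
have [c [w cw]] := generates_multiset_sums (cube d.+1) U_gen.
exists c.+1 => // j; elim: j => [|j IH].
  by rewrite exp0n // leq0n.
have Z0 : multiset_sums U (j * c.+1) != fset0.
  by apply/fset0Pn; exists 0; exact: multiset_sums_mem0.
have Q0 : [fset (0 : 'rV[int]_d.+1)] != fset0.
  by apply/fset0Pn; exists 0; rewrite inE.
have := brunn_minkowski Z0 Q0 (ler0n R j) ler01.
rewrite expr1n cardfs1 natr1 -!natrX !ler_nat sumset0l => /(_ IH (lexx _)) le.
apply: leq_trans le _; rewrite -(card_translate _ w).
apply/fsubset_leq_card/fsubsetP => x; rewrite mem_translate => /mem_sumsetP[y yU [z zc xE]].
rewrite -[x](subrK w) xE mulSn addnC multiset_sumsD -addrA mem_sumset //.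
have /fsubsetP : multiset_sums U c `<=` multiset_sums U c.+1 by apply: multiset_sums_homo.
by apply; exact: cw.
Qed.

Lemma lebesgue_outer_volE : lebesgue_outer (zonotope R U) = v%:E.
Proof.
rewrite /vol fineK // ge0_fin_numE ?lebesgue_outer_ge0 //.
(* The cover with j = 1 shows that the outer measure is finite, so [fine] loses nothing. *)
have [c /(_ 1%N erefl) le] := lebesgue_outer_zonotope R U_gen.
exact: le_lt_trans le (ltry _).
Qed.

Lemma multiset_sums_ge : exists c, forall j, v * j%:R ^+ d.+1 <= (N (j + c))%:R.
Proof.
have [c cP] := lebesgue_outer_zonotope R U_gen; exists c => -[|j].
  by rewrite expr0n mulr0 ler0n.
have := cP j.+1 erefl; rewrite lebesgue_outer_volE lee_fin.
by rewrite ler_pdivlMr // exprn_gt0 // ltr0n.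
Qed.

Lemma multiset_sums_le (e : R) : 0 < e ->
  exists J, forall j, (J <= j)%N -> (N j)%:R <= (v + e) * j%:R ^+ d.+1.
Proof.
by move=> e0; apply: card_multiset_sums_le => //; rewrite lebesgue_outer_volE.
Qed.

Lemma vol_zonotope_gt0 : 0 < v.
Proof.
rewrite lt_neqAle -lee_fin -lebesgue_outer_volE lebesgue_outer_ge0 andbT.
apply/eqP => v0; have [c c0 cP] := multiset_sums_growth.
have c0R : (0 : R) < c%:R ^+ d.+1 by rewrite exprn_gt0 // ltr0n.
(* At scale jc the count is at least j^(d+1) = (jc)^(d+1) / c^(d+1), twice what this [e] would allow
   for volume zero. *)
pose e : R := (c%:R ^+ d.+1)^-1 / 2.
have e0 : 0 < e by rewrite divr_gt0 // invr_gt0.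
have [J /(_ (J.+1 * c)%N)] := multiset_sums_le e0.
rewrite -v0 add0r => /(_ _) le; have {le} := le _.
have -> : (J <= J.+1 * c)%N by nia.
move=> /(_ erefl); apply/negP; rewrite -ltNge.
apply: lt_le_trans (_ : (J.+1 ^ d.+1)%:R <= _); last by rewrite ler_nat.
rewrite natrM exprMn natrX mulrCA mulrC gtr_pMl ?exprn_gt0 ?ltr0n //.
by rewrite /e mulrAC mulVf ?gt_eqF //; lra.
Qed.

Definition is_lattice_zonotope (t : R) (S : {fset 'rV[int]_d.+1}) :=
  [set` S]%classic = lattice_points (dilation t (zonotope R U)).

Lemma lattice_zonotope_card : exists c, forall j t S, 0 < t ->
  j%:R <= t < j.+1%:R -> is_lattice_zonotope t S -> (N j <= #|` S| <= N (j + c))%N.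
Proof.
have [c cP] := lattice_zonotope R U_gen; exists c => j t S t0 jt SE.
have [S' S'E] := cP j t t0 jt; suff -> : S = S' by [].
apply/fsetP => x; have : [set` S]%classic x <-> [set` S']%classic x by rewrite SE S'E.
by move=> /= [h1 h2]; apply/idP/idP.
Qed.

Lemma lattice_zonotope_exists t : 0 < t -> exists S, is_lattice_zonotope t S.
Proof.
move=> t0; have [c /(_ (Num.truncn t) t t0)] := lattice_zonotope R U_gen.
by move=> /(_ (truncn_itv (ltW t0)))[S SE _]; exists S.
Qed.

Lemma lattice_zonotope_asymptotics (e : R) : 0 < e ->
  exists2 T, 0 < T & forall t S, T <= t -> is_lattice_zonotope t S ->
    v * t ^+ d.+1 <= (1 + e) * #|` S|%:R /\ #|` S|%:R <= (1 + e) * v * t ^+ d.+1.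
Proof.
move=> e0; have v0 := vol_zonotope_gt0.
(* The upper bound spends two factors 1 + g: one on counting a multiple of Z_0, one on the bounded
   shift of the scale. *)
have [g g0 ge] := expr_small 2 e0.
have [c cP] := multiset_sums_ge.
have [c' c'P] := lattice_zonotope_card.
have [J JP] := multiset_sums_le (mulr_gt0 g0 v0).
have [T1 T10 T1P] := expr_shift d.+1 (ler0n R c.+1) g0.
have [T2 T20 T2P] := expr_shift d.+1 (ler0n R c') g0.
exists (T1 + T2 + c.+1%:R + J.+1%:R).
  by rewrite !addr_gt0 // ltr0n.
move=> t S Tt SE.
have c0 : 0 <= (c%:R : R) by rewrite ler0n.
have J0 : 0 <= (J%:R : R) by rewrite ler0n.
have c'0 : 0 <= (c'%:R : R) by rewrite ler0n.
move: Tt; rewrite -!natr1 => Tt.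
have t0 : 0 < t by lra.
have /andP[jt tj] := truncn_itv (ltW t0).
set j := Num.truncn t in jt tj.
have j0 : 0 <= (j%:R : R) by rewrite ler0n.
have /andP[lo hi] : (N j <= #|` S| <= N (j + c'))%N.
  by apply: c'P SE; rewrite ?jt.
move: tj; rewrite -natr1 => tj.
have cj : (c <= j)%N by rewrite -(ler_nat R); lra.
have Jj : (J <= j)%N by rewrite -(ler_nat R); lra.
have lo' : (N j)%:R <= #|` S|%:R :> R by rewrite ler_nat.
have hi' : #|` S|%:R <= (N (j + c'))%:R :> R by rewrite ler_nat.
have e1 : 1 + g <= 1 + e by move: ge; rewrite expr2; nra.
split.
  apply: (@le_trans _ _ ((1 + g) * #|` S|%:R)); last by rewrite ler_wpM2r.
  have := T1P (t - c.+1%:R); rewrite subrK -!natr1 => H.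
  apply: (@le_trans _ _ (v * ((1 + g) * (t - (c%:R + 1)) ^+ d.+1))).
    by rewrite ler_wpM2l ?(ltW v0) // H //; lra.
  rewrite mulrCA ler_wpM2l ?addr_ge0 ?(ltW g0) //.
  apply: le_trans lo'; have := cP (j - c)%N; rewrite subnK // => /(le_trans _); apply.
  rewrite ler_wpM2l ?(ltW v0) //; apply: lerXn2r; rewrite ?nnegrE ?ler0n ?natrB //; lra.
apply: le_trans hi' _; have := JP (j + c')%N (leq_trans Jj (leq_addr _ _)).
move=> /le_trans; apply.
have := T2P t _ => H.
apply: (@le_trans _ _ ((1 + g) * v * ((1 + g) * t ^+ d.+1))).
  rewrite (_ : v + g * v = (1 + g) * v); last by ring.
  apply: ler_wpM2l; first by rewrite mulr_ge0 ?addr_ge0 ?(ltW g0) ?(ltW v0).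
  apply: le_trans (H _); last by lra.
  by apply: lerXn2r; rewrite ?nnegrE ?natrD; lra.
have X0 : 0 <= v * t ^+ d.+1 by rewrite mulr_ge0 ?exprn_ge0 ?(ltW v0) ?(ltW t0).
have := ler_wpM2r X0 ge; rewrite expr2 => H2; lra.
Qed.

Lemma exprB_le (n : nat) (x y : R) : 0 <= x <= y ->
  y ^+ n.+1 - x ^+ n.+1 <= n.+1%:R * (y - x) * y ^+ n.
Proof.
move=> /andP[x0 xy]; elim: n => [|n IH]; first by rewrite !expr1 expr0; lra.
have y0 := le_trans x0 xy.
have h1 := ler_wpM2l y0 IH.
have h2 : x ^+ n.+1 <= y ^+ n.+1 by apply: lerXn2r; rewrite ?nnegrE.
have yx0 : 0 <= y - x by rewrite subr_ge0.
have h3 := ler_wpM2l yx0 h2.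
rewrite (_ : _ - _ = y * (y ^+ n.+1 - x ^+ n.+1) + (y - x) * x ^+ n.+1); last first.
  by rewrite !exprS; ring.
apply: le_trans (lerD h1 h3) _.
by rewrite [n.+2%:R]mulrS !exprS le_eqVlt; apply/orP; left; apply/eqP; ring.
Qed.

Lemma lattice_zonotope_edge_boundary (e : R) : 0 \notin U -> 0 < e ->
  exists2 T, 0 < T & forall t S, T <= t -> is_lattice_zonotope t S ->
    (edge_boundary U S)%:R <= (1 + e) * (d.+1%:R * v * t ^+ d).
Proof.
move=> U0 e0; have v0 := vol_zonotope_gt0.
have e20 : 0 < e / 2 by rewrite divr_gt0.
have [h h0 he] := expr_small d.+1 e20.
(* Makes 4 g (1 + e/2) = h e/2. The counting errors are divided by m, about ht, so g has to be small
   relative to h. *)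
pose g := (h / 2) * (e / 2) / (2 * (1 + e / 2)).
have g0 : 0 < g by rewrite /g divr_gt0 // ?mulr_gt0 //; lra.
have [T T0 TP] := lattice_zonotope_asymptotics g0.
(* The term 2/h forces ht >= 2, so truncation costs at most half: m >= ht/2. *)
exists (T + 2 / h); first by rewrite addr_gt0 // divr_gt0.
move=> t S Tt SE.
have h20 : 0 < 2 / h by rewrite divr_gt0.
have t0 : 0 < t by lra.
have ht : 2 <= h * t by rewrite mulrC -ler_pdivrMr //; lra.
have ht0 : 0 <= h * t by lra.
set m := Num.truncn (h * t).
have /andP[m1] := truncn_itv ht0; rewrite -/m -natr1 => m2.
have m0 : 0 <= (m%:R : R) by rewrite ler0n.
have [S' S'E] : exists S', is_lattice_zonotope (t + m%:R) S'.
  by apply: lattice_zonotope_exists; lra.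
have lo : v * t ^+ d.+1 <= (1 + g) * #|` S|%:R by have [] := TP t S _ SE; lra.
have hi : #|` S'|%:R <= (1 + g) * v * (t + m%:R) ^+ d.+1.
  by have [] := TP (t + m%:R) S' _ S'E; lra.
have := lattice_zonotope_boundary U0 t0 SE S'E.
rewrite -(ler_nat R) natrD natrM; set B : R := (edge_boundary U S)%:R => bd.
set X := t + m%:R in hi; set K := v * t ^+ d.
have K0 : 0 <= K by rewrite mulr_ge0 ?exprn_ge0 ?(ltW v0) ?(ltW t0).
have mgt0 : (0 : R) < m%:R by lra.
have X0 : 0 < X by rewrite /X; lra.
set D : R := d.+1%:R; have D1 : 1 <= D by rewrite /D ler1n.
pose A := v * X ^+ d; pose p := v * t ^+ d.+1.
have A0 : 0 <= A by rewrite mulr_ge0 ?exprn_ge0 ?(ltW v0) ?(ltW X0).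
have PE : v * X ^+ d.+1 = A * X by rewrite exprSr mulrA.
have pP : p <= A * X.
  rewrite -PE /p ler_wpM2l ?(ltW v0) //; apply: lerXn2r; rewrite ?nnegrE /X; lra.
have Pp : A * X - p <= D * m%:R * A.
  have tX : 0 <= t <= X by rewrite /X; apply/andP; split; lra.
  have := ler_wpM2l (ltW v0) (exprB_le d tX).
  rewrite mulrBr PE -/p => /le_trans; apply; rewrite (_ : X - t = m%:R); last by rewrite /X; ring.
  by rewrite /A mulrCA -/D.
have p0 : 0 <= p by rewrite mulr_ge0 ?exprn_ge0 ?(ltW v0) ?(ltW t0).
have Slo : p - g * p <= #|` S|%:R.
  have g1 : 0 < 1 + g by lra.
  rewrite -(ler_pM2l g1); apply: le_trans lo; rewrite -/p; nra.
(* D m comes from the mean value bound for (t + m)^(d+1) - t^(d+1), and 2 g X from the counting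
   errors for S and S'. *)
have s1 : m%:R * B <= A * (D * m%:R + 2 * g * X).
  rewrite -mulrA PE in hi; have gp := ler_wpM2l (ltW g0) pP; lra.
have s2 : 2 * g * X * h <= 4 * g * (1 + h) * m%:R.
  have X1 : X <= (1 + h) * t by rewrite /X; lra.
  have t2 : h * t <= 2 * m%:R by lra.
  have h1 : 0 <= 1 + h by lra.
  have z1 := ler_wpM2r (ltW h0) X1; have z2 := ler_wpM2l h1 t2.
  have z3 : X * h <= (1 + h) * (2 * m%:R) by lra.
  have := ler_wpM2l (ltW g0) z3; lra.
have s3 : B * h <= A * (D * h + 4 * g * (1 + h)).
  rewrite -(ler_pM2l mgt0).
  have z1 := ler_wpM2r (ltW h0) s1; have z2 := ler_wpM2l A0 s2; lra.
have s4 : A <= K * (1 + h) ^+ d.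
  rewrite /A /K -mulrA ler_wpM2l ?(ltW v0) // -exprMn.
  apply: lerXn2r; rewrite ?nnegrE ?(ltW X0) //; last by rewrite /X; lra.
  by rewrite mulr_ge0 ?addr_ge0 ?(ltW h0) ?(ltW t0).
have s5 : (1 + h) ^+ d <= 1 + e / 2.
  apply: le_trans he; rewrite exprSr ler_peMr ?exprn_ge0 ?addr_ge0 ?(ltW h0) //.
  by rewrite lerDl ltW.
have gE : 4 * g * (1 + e / 2) = h * (e / 2).
  by rewrite /g; field; lra.
suff fin : B * h <= (1 + e) * (D * K) * h.
  by move: fin; rewrite ler_pM2r // /K !mulrA.
have Dh0 : 0 <= D * h by rewrite mulr_ge0 ?(ltW h0) //; lra.
have h1 : 0 <= 1 + h by rewrite addr_ge0 // ltW.
have g40 : 0 <= 4 * g * (1 + h) by rewrite mulr_ge0 // mulr_ge0 // ltW.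
have w1 := ler_wpM2r (addr_ge0 Dh0 g40) s4.
apply: le_trans s3 _; apply: le_trans w1 _.
have w2 : (1 + h) ^+ d * (D * h) <= (1 + e / 2) * (D * h) by rewrite ler_wpM2r.
have w3 : (1 + h) ^+ d * (4 * g * (1 + h)) <= h * (e / 2).
  rewrite (_ : _ * (4 * g * _) = 4 * g * (1 + h) ^+ d.+1); last by rewrite exprS; ring.
  by rewrite -gE ler_wpM2l // mulr_ge0 // ltW.
have w4 := ler_wpM2l K0 (lerD w2 w3).
rewrite (_ : _ * (_ + _) = K * ((1 + h) ^+ d * (D * h) +
  (1 + h) ^+ d * (4 * g * (1 + h)))); last by ring.
apply: le_trans w4 _.
rewrite (_ : _ * _ * h = K * ((1 + e) * (D * h))); last by ring.
rewrite ler_wpM2l //.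
have w5 := ler_wpM2r (ltW (mulr_gt0 h0 e20)) D1.
by lra.
Qed.

End Asymptotics.

(** * Asymptotic isoperimetric bounds in terms of the cardinality *)

Section Isoperimetry.
Local Open Scope fset_scope.
Local Open Scope ring_scope.
Variables (R : realType) (d : nat) (U : {fset 'rV[int]_d.+1}).
Hypotheses (U_gen : generates U) (U_neq0 : 0 \notin U).
Local Notation N j := (#|` multiset_sums U j|).
Local Notation v := (vol (zonotope R U)).
Local Notation is_lattice_zonotope := (@is_lattice_zonotope R d U).

Definition vol_root : R := v `^ d.+1%:R^-1.
Definition card_root n : R := n%:R `^ d.+1%:R^-1.

Lemma vol_root_gt0 : 0 < vol_root.
Proof. by rewrite powR_gt0 // vol_zonotope_gt0. Qed.

Lemma powR_invK (x : R) : 0 <= x -> (x `^ d.+1%:R^-1) ^+ d.+1 = x.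
Proof.
by move=> x0; rewrite -powR_mulrn ?powR_ge0 // -powRrM mulVf ?pnatr_eq0 // powRr1.
Qed.

Lemma vol_rootX : vol_root ^+ d.+1 = v.
Proof. by rewrite powR_invK // ltW // vol_zonotope_gt0. Qed.

Lemma vol_root_scale t :
  d.+1%:R * v * t ^+ d = d.+1%:R * vol_root * (vol_root * t) ^+ d.
Proof. by rewrite -{1}vol_rootX exprMn exprS; ring. Qed.

Lemma card_root_ge0 n : 0 <= card_root n. Proof. exact: powR_ge0. Qed.

Lemma card_rootX n : card_root n ^+ d.+1 = n%:R. Proof. by rewrite powR_invK. Qed.

Lemma card_root_gt0 n : (0 < n)%N -> 0 < card_root n.
Proof. by move=> n0; rewrite powR_gt0 // ltr0n. Qed.

Lemma card_root_ge (k : R) : exists n0, forall n, (n0 <= n)%N -> k <= card_root n.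
Proof.
exists (Num.truncn (`|k| ^+ d.+1)).+1 => n nn.
apply: le_trans (ler_norm k) _; rewrite -(@ler_pXn2r _ d.+1) ?nnegrE ?card_root_ge0 //.
rewrite card_rootX ltW //; apply: lt_le_trans (truncnS_gt _) _.
by rewrite ler_nat.
Qed.

Lemma isoperimetric_boundE n :
  isoperimetric_bound R U n = d.+1%:R * vol_root * card_root n ^+ d.
Proof.
rewrite /isoperimetric_bound -/vol_root; congr (_ * _).
rewrite /card_root -[in RHS]powR_mulrn ?powR_ge0 // -powRrM; congr (_ `^ _).
by rewrite -[d.+1%:R]natr1; field; rewrite natr1 pnatr_eq0.
Qed.

Lemma isoperimetric_bound_ge0 n : 0 <= isoperimetric_bound R U n.
Proof.
by rewrite isoperimetric_boundE !mulr_ge0 ?ler0n ?exprn_ge0 ?card_root_ge0 ?(ltW vol_root_gt0).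
Qed.

(** Many points force a large t, so the boundary estimate at scale t applies; the point count then
    bounds t in terms of n. *)
Lemma lattice_zonotope_isoperimetric (e : R) : 0 < e ->
  exists n0, forall n t S, (n0 <= n)%N -> 0 < t -> is_lattice_zonotope t S ->
    #|` S| = n -> (edge_boundary U S)%:R <= (1 + e) * isoperimetric_bound R U n.
Proof.
move=> e0; have v0 := vol_zonotope_gt0 R U_gen; have r0 := vol_root_gt0.
have [g g0 ge] := expr_small d.+1 e0.
have [T1 T10 T1P] := lattice_zonotope_asymptotics U_gen g0.
have [T2 T20 T2P] := lattice_zonotope_edge_boundary U_gen U_neq0 g0.
have [c cP] := lattice_zonotope_card R U_gen.
exists (N (Num.truncn (T1 + T2) + c)).+1 => n t S nn t0 SE Sn.
have [tT|tT] := ltP t (T1 + T2).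
  have /andP[_] := cP _ t S t0 (truncn_itv (ltW t0)) SE.
  move=> le; exfalso; move: nn; rewrite leqNgt ltnS => /negP; apply.
  rewrite -Sn (leq_trans le) // fsubset_leq_card // multiset_sums_homo // leq_add2r.
  by apply: le_truncn; exact: ltW.
have [lo _] := T1P t S (le_trans (ler_wpDr (ltW T20) (lexx _)) tT) SE.
have bd := T2P t S (le_trans (ler_wpDl (ltW T10) (lexx _)) tT) SE.
have g1 : 0 <= 1 + g by rewrite addr_ge0 // ltW.
have tx : vol_root * t <= (1 + g) * card_root n.
  rewrite -(@ler_pXn2r _ d.+1) ?nnegrE ?mulr_ge0 ?card_root_ge0 ?(ltW r0) ?(ltW t0) //.
  rewrite !exprMn vol_rootX card_rootX; apply: le_trans lo _; rewrite Sn ler_wpM2r //.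
  by rewrite exprS ler_peMr // exprn_ege1 // lerDl ltW.
apply: le_trans bd _; rewrite isoperimetric_boundE.
apply: (@le_trans _ _ ((1 + g) ^+ d.+1 * (d.+1%:R * vol_root * card_root n ^+ d))); last first.
  by rewrite ler_wpM2r // !mulr_ge0 ?ler0n ?exprn_ge0 ?card_root_ge0 ?(ltW r0).
rewrite vol_root_scale.
rewrite exprS -[leRHS]mulrA; apply: ler_wpM2l => //.
rewrite [leRHS]mulrCA; apply: ler_wpM2l; first by rewrite mulr_ge0 ?ler0n ?(ltW r0).
rewrite -exprMn; apply: lerXn2r; rewrite ?nnegrE ?mulr_ge0 ?card_root_ge0 ?(ltW r0) ?(ltW t0) //.
Qed.

Lemma lattice_zonotope_near (e : R) : 0 < e ->
  exists n0, forall n, (n0 <= n)%N -> exists t S,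
    [/\ 0 < t, is_lattice_zonotope t S, (n <= #|` S|)%N,
        #|` S|%:R <= (1 + e) * n%:R &
        (edge_boundary U S)%:R <= (1 + e) * isoperimetric_bound R U n].
Proof.
move=> e0; have v0 := vol_zonotope_gt0 R U_gen; have r0 := vol_root_gt0.
have [g g0 ge] := expr_small d.+2 e0.
have g1 : 0 < 1 + g by rewrite addr_gt0.
have [T1 T10 T1P] := lattice_zonotope_asymptotics U_gen g0.
have [T2 T20 T2P] := lattice_zonotope_edge_boundary U_gen U_neq0 g0.
have [n0 n0P] := card_root_ge (vol_root * (T1 + T2)).
exists n0.+1 => n nn.
have x0 : 0 < card_root n by rewrite card_root_gt0 // (leq_trans _ nn).
(* The volume of tZ becomes (1 + g)^(d+1) n; the surplus outweighs the counting error, so S has at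
   least n points. *)
pose t := (1 + g) * card_root n / vol_root.
have t0 : 0 < t by rewrite divr_gt0 // mulr_gt0.
have tT : T1 + T2 <= t.
  rewrite ler_pdivlMr // mulrC; apply: le_trans (n0P n (ltnW nn)) _.
  by rewrite ler_peMl ?(ltW x0) // lerDl ltW.
have [S SE] := lattice_zonotope_exists U_gen t0.
have [lo hi] := T1P t S (le_trans (ler_wpDr (ltW T20) (lexx _)) tT) SE.
have bd := T2P t S (le_trans (ler_wpDl (ltW T10) (lexx _)) tT) SE.
have rt : vol_root * t = (1 + g) * card_root n by rewrite /t mulrC divfK ?gt_eqF.
have vt : v * t ^+ d.+1 = (1 + g) ^+ d.+1 * n%:R.
  by rewrite -vol_rootX -exprMn rt exprMn card_rootX.
exists t, S; split => //.
- rewrite -(ler_nat R) -(ler_pM2l g1); apply: le_trans lo; rewrite vt ler_wpM2r //.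
  by rewrite exprS ler_peMr ?(ltW g1) // exprn_ege1 // lerDl ltW.
- apply: le_trans hi _; rewrite -mulrA vt mulrA -exprS.
  by rewrite ler_wpM2r.
apply: le_trans bd _; rewrite isoperimetric_boundE.
rewrite vol_root_scale.
rewrite rt exprMn (_ : _ * _ = (1 + g) ^+ d.+1 * (d.+1%:R * vol_root * card_root n ^+ d));
  last by rewrite exprS; ring.
rewrite ler_wpM2r ?mulr_ge0 ?ler0n ?exprn_ge0 ?card_root_ge0 ?(ltW r0) //.
apply: le_trans ge; rewrite [leRHS]exprS ler_peMl ?exprn_ge0 ?(ltW g1) //.
by rewrite lerDl ltW.
Qed.

Lemma edge_boundary_asymptotic_ge (e : R) : 0 < e ->
  exists n0, forall (S : {fset 'rV[int]_d.+1}), (n0 <= #|` S|)%N ->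
    isoperimetric_bound R U #|` S| <= (1 + e) * (edge_boundary U S)%:R.
Proof.
move=> e0; have v0 := vol_zonotope_gt0 R U_gen; have r0 := vol_root_gt0.
(* The four factors pay for |S + rZ_0| against |S| (one, inside k), |(r + m)Z_0| against |rZ_0|
   (two) and m against m - c1 - c2 (one). *)
have [g g0 ge] := expr_small 4 e0.
have g1 : 0 < 1 + g by rewrite addr_gt0.
have [c1 c1P] := multiset_sums_ge R U_gen.
have [c2 c2P] := edge_boundary_ge R U_gen.
have [m [m0 cm mg]] : exists m, [/\ (0 < m)%N, (c1 + c2 < m)%N &
    m%:R <= (1 + g) * (m - (c1 + c2))%:R :> R].
  (* Then m - C exceeds C/g, so the loss C is at most g (m - C). *)
  pose C := (c1 + c2)%N; pose m := (C + (Num.truncn (C%:R / g)).+1)%N.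
  exists m; split; [by rewrite /m addnS|by rewrite /m addnS ltnS leq_addr|].
  rewrite /m addKn natrD mulrDl mul1r addrC lerD2l mulrC -ler_pdivrMr //.
  by rewrite ltW // truncnS_gt.
have c2m : (c2 <= m)%N by clear -cm; lia.
have mE : (m - (c1 + c2) + c1 = m - c2)%N by clear -cm; lia.
have [T T0 TP] := expr_shift d.+1 (ler0n R (m + c1)) g0.
have [J JP] := multiset_sums_le U_gen (mulr_gt0 g0 v0).
(* With r - c1 at least T, passing from scale r - c1 to r + m costs only a factor 1 + g. *)
pose r := (c1 + J + (Num.truncn T).+1)%N.
have Nr : (N (r + m))%:R <= (1 + g) ^+ 2 * (N r)%:R :> R.
  have Jr : (J <= r + m)%N by rewrite /r -!addnA addnCA leq_addr.
  have c1r : (c1 <= r)%N by rewrite /r -!addnA leq_addr.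
  apply: le_trans (JP _ Jr) _.
  have -> : v + g * v = (1 + g) * v by ring.
  have h1 := c1P (r - c1)%N; rewrite subnK // in h1.
  have h2 := TP (r - c1)%:R _.
  have {}h2 : ((r - c1)%:R + (m + c1)%:R) ^+ d.+1 <= (1 + g) * (r - c1)%:R ^+ d.+1 :> R.
    apply: h2; apply: le_trans (ltW (truncnS_gt T)) _.
    by rewrite ler_nat /r -addnA addKn leq_addl.
  rewrite -natrD (_ : r - c1 + (m + c1) = r + m)%N in h2; last by rewrite [(m + _)%N]addnC addnA subnK.
  rewrite expr2 -!mulrA; apply: ler_wpM2l; first exact: ltW.
  apply: le_trans (ler_wpM2l (ltW v0) h2) _.
  by rewrite mulrCA; apply: ler_wpM2l => //; exact: ltW.
have Nr0 : (0 : R) < (N r)%:R.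
  by rewrite ltr0n cardfs_gt0; apply/fset0Pn; exists 0; exact: multiset_sums_mem0.
(* When the boundary is below the bound, of order n^(1 - 1/(d+1)), this makes the correction |rZ_0|
   r B at most g n. *)
have [n0 n0P] := card_root_ge ((N r)%:R * r%:R * (d.+1%:R * vol_root) / g).
exists n0.+1 => S nS; set n := #|` S| in nS *.
set B : R := (edge_boundary U S)%:R.
have B0 : 0 <= B by rewrite ler0n.
have [|Bb] := lerP (isoperimetric_bound R U n) B.
  by move=> /le_trans; apply; rewrite ler_peMl // lerDl ltW.
have x0 : 0 < card_root n by rewrite card_root_gt0 // (leq_trans _ nS).
have k0 : 0 < (1 + g) * card_root n by rewrite mulr_gt0.
pose a := vol_root * (m - (c1 + c2))%:R.
have a0 : 0 <= a by rewrite mulr_ge0 ?ler0n ?(ltW r0).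
have := c2P S r m a ((1 + g) * card_root n) c2m a0 _ k0 _.
have -> : a ^+ d.+1 <= (N (m - c2))%:R.
  rewrite exprMn vol_rootX; have := c1P (m - (c1 + c2))%N.
  by rewrite mE.
move=> /(_ erefl).
have -> : (n + N r * (r * edge_boundary U S))%:R <= ((1 + g) * card_root n) ^+ d.+1.
  rewrite exprMn card_rootX natrD !natrM -/B.
  apply: (@le_trans _ _ ((1 + g) * n%:R)); last first.
    by rewrite ler_wpM2r // exprS ler_peMr ?(ltW g1) // exprn_ege1 // lerDl ltW.
  rewrite mulrDl mul1r lerD2l mulrA.
  have Nr1 : 0 <= (N r)%:R * r%:R :> R by rewrite mulr_ge0.
  apply: le_trans (ler_wpM2l Nr1 (ltW Bb)) _.
  have := n0P n (ltnW nS); rewrite ler_pdivrMr // => H.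
  rewrite isoperimetric_boundE mulrA.
  have -> : g * n%:R = card_root n * g * card_root n ^+ d by rewrite -card_rootX exprS; ring.
  by rewrite ler_wpM2r ?exprn_ge0 ?(ltW x0).
move=> /(_ erefl); rewrite !natrM -/B -/n => main.
have X0 : 0 < (N r)%:R * card_root n * (m - (c1 + c2))%:R.
  by rewrite !mulr_gt0 // ltr0n subn_gt0.
rewrite isoperimetric_boundE -(ler_pM2l X0).
have -> : (N r)%:R * card_root n * (m - (c1 + c2))%:R * (d.+1%:R * vol_root * card_root n ^+ d)
  = d.+1%:R * a * ((N r)%:R * n%:R).
  by rewrite -[n%:R]card_rootX exprS /a; ring.
apply: le_trans main _.
have z1 : (N (r + m))%:R * (m%:R * B) <=
    (1 + g) ^+ 2 * (N r)%:R * ((1 + g) * (m - (c1 + c2))%:R * B).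
  by apply: ler_pM; rewrite ?mulr_ge0 ?ler0n // ler_wpM2r.
apply: le_trans (ler_wpM2l (ltW k0) z1) _.
have -> : (1 + g) * card_root n * ((1 + g) ^+ 2 * (N r)%:R * ((1 + g) * (m - (c1 + c2))%:R * B))
  = (1 + g) ^+ 4 * ((N r)%:R * card_root n * (m - (c1 + c2))%:R * B) by ring.
rewrite [leRHS]mulrCA; apply: ler_wpM2r => //.
by rewrite mulr_ge0 ?(ltW X0).
Qed.

End Isoperimetry.

Theorem theorem1 (R : realType) (d : nat) (d_gt0 : (0 < d)%N)
    (U : {fset 'rV[int]_d}) (U_neq0 : 0 \notin U) (U_gen : generates U)
    (delta : R) (delta_gt0 : 0 < delta) :
  exists n0 : nat, forall n : nat, (n0 <= n)%N ->
    [/\ (1 - delta) * isoperimetric_bound R U n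
          <= (edge_isoperimetry U n)%:R
          <= (1 + delta) * isoperimetric_bound R U n,
        (forall (t : R) (S : {fset 'rV[int]_d}), 0 < t ->
           [set` S] = lattice_points (dilation t (zonotope R U)) ->
           #|` S| = n ->
           (edge_boundary U S)%:R <= (1 + delta) * isoperimetric_bound R U n) &
        (exists (t : R) (S : {fset 'rV[int]_d}),
           [/\ 0 < t,
               [set` S] = lattice_points (dilation t (zonotope R U)),
               (n <= #|` S|)%N,
               (#|` S|)%:R <= (1 + delta) * n%:R &
               (edge_boundary U S)%:R
                 <= (1 + delta) * isoperimetric_bound R U n])].
Proof.
case: d d_gt0 U U_neq0 U_gen => // d _ U U_neq0 U_gen.
have [n1 n1P] := edge_boundary_asymptotic_ge U_gen delta_gt0.
have [n2 n2P] := lattice_zonotope_isoperimetric U_gen U_neq0 delta_gt0.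
have [n3 n3P] := lattice_zonotope_near U_gen U_neq0 delta_gt0.
exists (n1 + n2 + n3)%N => n nn.
have [t [S [t0 SE nS Sn bd]]] := n3P n (leq_trans (leq_addl _ _) nn).
split; last by exists t, S.
- have [[S0 S0n S0E] _] := edge_isoperimetryP U n (ltn0Sn d).
  apply/andP; split.
    rewrite -S0E.
    have : isoperimetric_bound R U n <= (1 + delta) * (edge_boundary U S0)%:R.
      by rewrite -S0n; apply: n1P; rewrite S0n; lia.
    have := isoperimetric_bound_ge0 R U_gen n.
    have : 0 <= (edge_boundary U S0)%:R :> R by rewrite ler0n.
    move: (isoperimetric_bound R U n) (_%:R) => b B B0 b0 le.
    (* For delta > 1 the left side is nonpositive; otherwise (1 - delta)(1 + delta) <= 1
       suffices. *)
    have [d1|d1] := lerP delta 1; last by nra.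
    have := @ler_wpM2l _ (1 - delta) _ _ _ le; rewrite subr_ge0 => /(_ d1); nra.
  (* The lattice zonotope may have more than n points; deleting the surplus does not increase the
     boundary. *)
  apply: le_trans bd; rewrite ler_nat; exact: edge_isoperimetry_le.
- move=> s T s0 TE Tn; apply: n2P s0 TE Tn; lia.
Qed.
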